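(* Fix any integer $d\geq 3$, any prime power $q$, and a set $S\subseteq [d-1]$ with $|S|\geq 2$. Let $s$ be any face of the projected flags complex $\mathcal{B}^{d,S}_q$ of co-dimension at least $2$ (i.e. $|S|-|s|\geq 2$). Then the second largest eigenvalue of the normalized adjacency operator of the underlying graph of the link of $s$ in $\mathcal{B}^{d,S}_q$ is at most $\frac{2}{(|S|-|s|-1)(\sqrt{q}-1)}$. In particular, $\mathcal{B}^{d,S}_q$ is a $\frac{2}{\sqrt{q}-1}$-(one-sided) local spectral expander. Moreover, $\mathcal{B}^{d,S}_q$ is a $\frac{1}{\sqrt{q}}$-product.
   Context: For a prime power $q$, integer $d$, and $S=\{s_1<\dots<s_k\}\subseteq[d-1]$, the projected flags complex $\mathcal{B}^{d,S}_q$ is the $k$-partite simplicial complex whose vertices are the subspaces $W\subseteq\mathbb{F}_q^d$ with $\dim W\in S$ (the color of a vertex is its dimension), and whose top faces are the chains $W_1\subset W_2\subset\cdots\subset W_k$ with $\dim W_i=s_i$; faces are all subsets of top faces. The complex is weighted by the uniform distribution on top faces; the distribution on $i$-faces is obtained by sampling a top face and a uniformly random subset of size $i+1$. The link of a face $s$ is $X_s=\{t\setminus s: t\in X, t\supseteq s\}$ with the induced (conditional) distribution; its underlying graph has vertices $X_s(0)$, edges $X_s(1)$, edge weights from this distribution, and normalized adjacency operator $\mathsf{A}f(v)=\frac{1}{2\pi_0(v)}\sum_{u\sim v}\pi_1(uv)f(u)$, where $\pi_0$ is the induced vertex distribution. A $D$-dimensional complex $X$ is a $\lambda$-(one-sided)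 local spectral expander if for every face $s$ of dimension at most $D-2$ (including the empty face) the second largest eigenvalue of the underlying graph of $X_s$ is at most $\lambda$. A partite complex $X$ is a $\lambda$-product if for every face $\tau$ of co-dimension at least $2$ and every two colors $i\neq j$ not in the colors of $\tau$, the bipartite graph induced on vertices of colors $i,j$ in $X_\tau$ has second largest eigenvalue at most $\lambda$. *)

(* Defs.v *)
From HB Require Import structures.
From mathcomp Require Import all_boot all_order all_algebra.
From mathcomp Require Import reals.
Set Implicit Arguments. Unset Strict Implicit. Unset Printing Implicit Defensive.
Import Order.TTheory GRing.Theory Num.Theory.
Local Open Scope ring_scope.

Import VectorInternalTheory.
HB.instance Definition _ (F : finFieldType) (d : nat) :=
  [Finite of {vspace 'rV[F]_d} by <:].

(* The ambient vector space F_q^d is 'rV[F]_d; vertices of B^{d,S}_q are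
   subspaces W : {vspace 'rV[F]_d} with (\dim W) \in S; the colour of W is \dim W.
   S is given as a set of indices in 'I_d, all nonzero, i.e. S \subseteq [d-1]. *)

Definition chainb (F : finFieldType) (d : nat) (T : {set {vspace 'rV[F]_d}}) : bool :=
  [forall U in T, forall W in T, (U <= W)%VS || (W <= U)%VS].

Definition top_face (F : finFieldType) (d : nat) (S : {set 'I_d})
  (T : {set {vspace 'rV[F]_d}}) : bool :=
  chainb T && perm_eq [seq (\dim U)%N | U <- enum T] [seq val i | i <- enum S].

Definition tops (F : finFieldType) (d : nat) (S : {set 'I_d}) :
  {set {set {vspace 'rV[F]_d}}} := [set T | top_face S T].

Definition face (F : finFieldType) (d : nat) (S : {set 'I_d})
  (s : {set {vspace 'rV[F]_d}}) : bool := [exists T in tops F S, s \subset T].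

(* top faces containing s (uniformly distributed: the conditional distribution) *)
Definition tops_at (F : finFieldType) (d : nat) (S : {set 'I_d})
  (s : {set {vspace 'rV[F]_d}}) := [set T in tops F S | s \subset T].

Definition codim (F : finFieldType) (d : nat) (S : {set 'I_d})
  (s : {set {vspace 'rV[F]_d}}) : nat := (#|S| - #|s|)%N.

Definition colors (F : finFieldType) (d : nat) (s : {set {vspace 'rV[F]_d}}) : seq nat :=
  [seq (\dim U)%N | U <- enum s].

(* normalized adjacency operator  A f(v) = 1/(2 pi0 v) sum_u pi1(uv) f(u),
   as a matrix acting on column vectors indexed by an enumeration of Vs *)
Definition graph_mx (R : realType) (T : finType) (Vs : {set T})
  (pi0 : T -> R) (pi1 : T -> T -> R) : 'M[R]_#|Vs| :=
  \matrix_(i, j) (pi1 (enum_val i) (enum_val j) / (2 * pi0 (enum_val i))).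

Definition second_eig_le (R : realType) (n : nat) (M : 'M[R]_n) (lam : R) : Prop :=
  exists rs : seq R, char_poly M = \prod_(r <- rs) ('X - r%:P)
    /\ nth 0 (sort (fun x y : R => y <= x) rs) 1 <= lam.

Definition link_verts (F : finFieldType) (d : nat) (S : {set 'I_d})
  (s : {set {vspace 'rV[F]_d}}) : {set {vspace 'rV[F]_d}} :=
  [set v | (v \notin s) && [exists T in tops_at S s, v \in T]].

(* pi0(v): sample a top face t >= s uniformly, then a uniform vertex of t \ s *)
Definition link_pi0 (R : realType) (F : finFieldType) (d : nat) (S : {set 'I_d})
  (s : {set {vspace 'rV[F]_d}}) (v : {vspace 'rV[F]_d}) : R :=
  #|[set T in tops_at S s | v \in T]|%:R
    / (#|tops_at S s|%:R * (codim S s)%:R).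

(* pi1(uv): sample a top face t >= s uniformly, then a uniform 2-subset of t \ s *)
Definition link_pi1 (R : realType) (F : finFieldType) (d : nat) (S : {set 'I_d})
  (s : {set {vspace 'rV[F]_d}}) (u v : {vspace 'rV[F]_d}) : R :=
  if u != v then
    #|[set T in tops_at S s | (u \in T) && (v \in T)]|%:R
      / (#|tops_at S s|%:R * ('C(codim S s, 2))%:R)
  else 0.

Definition link_mx (R : realType) (F : finFieldType) (d : nat) (S : {set 'I_d})
  (s : {set {vspace 'rV[F]_d}}) :=
  graph_mx (link_verts S s) (link_pi0 R S s) (link_pi1 R S s).

Definition prod_verts (F : finFieldType) (d : nat) (S : {set 'I_d})
  (tau : {set {vspace 'rV[F]_d}}) (i j : 'I_d) : {set {vspace 'rV[F]_d}} :=
  [set v | (((\dim v)%N == val i) || ((\dim v)%N == val j))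
           && [exists T in tops_at S tau, v \in T]].

(* edge distribution: sample a top face t >= tau, take its i- and j-coloured vertices *)
Definition prod_pi1 (R : realType) (F : finFieldType) (d : nat) (S : {set 'I_d})
  (tau : {set {vspace 'rV[F]_d}}) (u v : {vspace 'rV[F]_d}) : R :=
  if u != v then
    #|[set T in tops_at S tau | (u \in T) && (v \in T)]|%:R / #|tops_at S tau|%:R
  else 0.

(* induced vertex distribution: a uniform endpoint of a random edge *)
Definition prod_pi0 (R : realType) (F : finFieldType) (d : nat) (S : {set 'I_d})
  (tau : {set {vspace 'rV[F]_d}}) (v : {vspace 'rV[F]_d}) : R :=
  #|[set T in tops_at S tau | v \in T]|%:R / (2 * #|tops_at S tau|%:R).

Definition prod_mx (R : realType) (F : finFieldType) (d : nat) (S : {set 'I_d})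
  (tau : {set {vspace 'rV[F]_d}}) (i j : 'I_d) :=
  graph_mx (prod_verts S tau i j) (prod_pi0 R S tau) (prod_pi1 R S tau).

(* lambda-(one-sided) local spectral expander: every face of dimension
   <= D-2 (D = |S|-1), i.e. |s| + 2 <= |S|, including the empty face *)
Definition local_spectral_expander (R : realType) (F : finFieldType) (d : nat)
  (S : {set 'I_d}) (lam : R) : Prop :=
  forall s : {set {vspace 'rV[F]_d}}, face S s -> (#|s| + 2 <= #|S|)%N ->
    second_eig_le (link_mx R S s) lam.

Definition lambda_product (R : realType) (F : finFieldType) (d : nat)
  (S : {set 'I_d}) (lam : R) : Prop :=
  forall tau : {set {vspace 'rV[F]_d}}, face S tau -> (#|tau| + 2 <= #|S|)%N ->
    forall i j : 'I_d, i \in S -> j \in S -> i != j ->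
      val i \notin colors tau -> val j \notin colors tau ->
      second_eig_le (prod_mx R S tau i j) lam.

(* Main.v *)
(* The count of top faces through a chain depends only on the dimensions in the chain, so in the
   link of [s] the vertices of two dimensions [i < j] form a biregular graph with uniform edges.
   If some member of [s] has dimension strictly between [i] and [j] this graph is complete
   bipartite; otherwise it is the inclusion graph between two levels of an interval [A, B] of the
   subspace lattice. In such an interval the commutation of the up and down operators gives, by
   induction on the level, a bound q^(-1/2) for each one-step operator on mean-zero functions, and
   composing steps bounds the operator between levels [i] and [j] by q^(-|i-j|/2). In a link with
   k colours the walk is 1/(k-1) times the sum of the operators over pairs of colours: on
   functions constant on colours and of mean zero it is negative, and on functions of mean zero on
   each colour a Schur test bounds it by the largest row sum of q^(-|i-j|/2), that is by
   2 (q^(-1/2) + q^(-1) + ...) = 2 / (sqrt q - 1). *)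
Require Import Defs.
From HB Require Import structures.
From mathcomp Require Import all_boot all_order all_algebra.
From mathcomp Require Import reals.
From mathcomp Require complex.
From mathcomp Require Import finfield ring lra zify.
Import Order.TTheory GRing.Theory Num.Theory.
Local Open Scope ring_scope.
Set Implicit Arguments. Unset Strict Implicit. Unset Printing Implicit Defensive.

(** * Characteristic polynomials and sorted spectra *)

Lemma char_poly_diag_mx (K : comNzRingType) n (a : 'rV[K]_n) :
  char_poly (diag_mx a) = \prod_i ('X - (a 0 i)%:P).
Proof.
rewrite char_poly_trig; last first.
  by apply/is_trig_mxP => i j ij; rewrite mxE; case: eqP ij => [->|]; rewrite ?ltnn.
by apply: eq_bigr => i _; rewrite mxE eqxx.
Qed.

Lemma char_poly_similar (K : fieldType) n (P A : 'M[K]_n) :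
  P \in unitmx -> char_poly (invmx P *m A *m P) = char_poly A.
Proof.
move=> Pu; rewrite /char_poly /char_poly_mx.
have PVP : map_mx polyC (invmx P) *m map_mx polyC P = 1%:M.
  by rewrite -map_mxM mulVmx // map_scalar_mx.
have -> : 'X%:M - map_mx polyC (invmx P *m A *m P) =
   map_mx polyC (invmx P) *m ('X%:M - map_mx polyC A) *m map_mx polyC P.
  rewrite mulmxBr mulmxBl !map_mxM; congr (_ - _).
  by rewrite mul_mx_scalar -scalemxAl PVP scalemx1.
by rewrite !det_mulmx mulrAC -det_mulmx PVP det1 mul1r.
Qed.

(** In a decreasing list the first entry dominates the second, so both exceed [lam]. The default 0
    of [nth] cannot exceed [lam], which rules out lists with fewer than two entries. *)
Lemma sorted_second_gt (R : realDomainType) (s : seq R) lam :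
  0 <= lam -> lam < nth 0 (sort (fun x y : R => y <= x) s) 1 ->
  (1 < count (fun x => lam < x)%R s)%N.
Proof.
move=> lam0; have ps := permEl (perm_sort (fun x y : R => y <= x) s).
rewrite -(permP ps).
have : sorted (fun x y : R => y <= x) (sort (fun x y : R => y <= x) s).
  by apply: sort_sorted => x y; rewrite orbC le_total.
case: (sort _ s) => [|a [|b t]] /=; rewrite ?ltNge ?lam0 // => /andP[ba _].
by rewrite -!ltNge => lb; rewrite lb (lt_le_trans lb ba).
Qed.

(** * A Rayleigh quotient test for reversible matrices *)

Section Spectral.
Import complex.
Variable R : realType.
Local Notation toC := (real_complex R).

Lemma real_complex_real (x : R) : toC x \is Num.real.
Proof. by rewrite realE -(rmorph0 toC) !lecR; apply: num_real. Qed.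

Lemma real_complex_Re (z : R[i]) : z \is Num.real -> toC (complex.Re z) = z.
Proof.
by case: z => a b; rewrite realE !lecE /= => /orP[] /andP[/eqP] => [->|<-].
Qed.


Lemma complex_Re_sum (I : finType) (P : pred I) (z : I -> R[i]) :
  complex.Re (\sum_(i | P i) z i) = \sum_(i | P i) complex.Re (z i).
Proof. by apply: (big_morph (@complex.Re R)) => // -[a b] [c e]. Qed.

Lemma complex_Im_sum (I : finType) (P : pred I) (z : I -> R[i]) :
  complex.Im (\sum_(i | P i) z i) = \sum_(i | P i) complex.Im (z i).
Proof. by apply: (big_morph (@complex.Im R)) => // -[a b] [c e]. Qed.

Lemma normC_complex_sqr (z : R[i]) :
  z * z^* = toC (complex.Re z ^+ 2 + complex.Im z ^+ 2).
Proof.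
case: z => a b; have -> : (Complex a b)^* = Complex a (- b) by [].
by apply/eqP; rewrite eq_complex /=; apply/andP; split; apply/eqP; ring.
Qed.

(** Conjugating [M] by the diagonal matrix of the square roots of [p] gives a real symmetric matrix,
    which is diagonalised over [R[i]]. Two eigenvalues above [lam] would yield a vector of mean zero
    violating the quadratic bound. *)
Lemma second_eig_le_rayleigh n (M : 'M[R]_n) (p : 'I_n -> R) lam :
  0 <= lam -> (forall i, 0 < p i) ->
  (forall i j, p i * M i j = p j * M j i) ->
  (forall f : 'I_n -> R, \sum_i p i * f i = 0 ->
     \sum_i \sum_j p i * M i j * f i * f j <= lam * \sum_i p i * f i ^+ 2) ->
  second_eig_le M lam.
Proof.
move=> lam0 p0 symM ray.
pose w i := Num.sqrt (p i).
have w0 i : 0 < w i by rewrite sqrtr_gt0.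
have wn i : w i != 0 by rewrite gt_eqF.
have w2 i : w i * w i = p i by rewrite -expr2 sqr_sqrtr // ltW.
pose B := \matrix_(i, j) (w i * M i j / w j).
have symB i j : B i j = B j i.
  rewrite !mxE; apply: (mulfI (wn i)); apply: (mulIf (wn j)).
  transitivity (p i * M i j); first by rewrite -w2; field; rewrite wn.
  by rewrite symM -w2; field; rewrite wn.
pose A := map_mx toC B.
have hA : A \is hermsymmx.
  apply: realsym_hermsym; last by apply/mxOverP => i j; rewrite mxE real_complex_real.
  apply/is_hermitianmxP; rewrite expr0 scale1r map_mx_id //.
  by apply/matrixP => i j; rewrite !(mxE map_mx_key, mxE trmx_key) symB.
have /orthomx_spectralP := hermitian_normalmx hA.
have := hermitian_spectral_diag_real hA; have := spectral_unitarymx A.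
set P := spectralmx A; set sp := spectral_diag A => Pu /mxOverP spR defA.
pose r i := complex.Re (sp 0 i).
have rE i : toC (r i) = sp 0 i by rewrite real_complex_Re.
exists [seq r i | i <- enum 'I_n]; split.
  (* [toC] is injective on polynomials, so the factorisation may be checked over [R[i]], where [M]
     is similar to the spectral diagonal. *)
  apply: (@map_poly_inj _ _ toC).
  rewrite map_char_poly /= rmorph_prod /= big_map big_enum /=.
  pose D := diag_mx (\row_i toC (w i)).
  have Du : D \in unitmx.
    rewrite unitmxE det_diag unitfE; apply/prodf_neq0 => i _.
    by rewrite mxE fmorph_eq0.
  have -> : map_mx toC M = invmx (P *m D) *m diag_mx sp *m (P *m D).
    have PDu : P *m D \in unitmx by rewrite unitmx_mul Du unitarymx_unit.
    have DM : D *m map_mx toC M = A *m D.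
      apply/matrixP => i j; rewrite mul_diag_mx mul_mx_diag !mxE -!rmorphM /=.
      by congr (toC _); rewrite mulfVK.
    have: P *m D *m map_mx toC M = diag_mx sp *m (P *m D).
      rewrite -mulmxA DM {1}defA !mulmxA mulmxV ?mul1mx //.
      exact: unitarymx_unit.
    by move=> /(congr1 (mulmx (invmx (P *m D)))); rewrite mulKmx // mulmxA.
  rewrite char_poly_similar ?unitmx_mul ?Du ?unitarymx_unit // char_poly_diag_mx.
  by apply: eq_bigr => i _; rewrite rmorphB /= map_polyX map_polyC /= rE.
rewrite leNgt; apply/negP => /(sorted_second_gt lam0).
rewrite count_map enumT -size_filter -cardE => /card_gt1P[k [l [/= kr lr kl]]].
(* Two eigenvectors with eigenvalue above [lam] span a vector orthogonal to the weights. *)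
pose u i := \sum_j P i j * toC (w j).
have [y1 [y2 [yu yn]]] : exists y1 y2 : R[i],
    y1 * u k + y2 * u l = 0 /\ (y1 != 0) || (y2 != 0).
  have [u0|un] := eqVneq (u k) 0.
    by exists 1, 0; rewrite u0 mulr0 mul0r addr0 oner_eq0.
  by exists (- u l), (u k); rewrite un orbT mulNr [u l * _]mulrC addNr.
have orth a b : \sum_j P a j * (P b j)^* = (a == b)%:R.
  have /unitarymxP /matrixP /(_ a b) := Pu; rewrite !mxE => <-.
  by apply: eq_bigr => j _; rewrite !mxE.
have comb a b c e : \sum_j (a * P k j + b * P l j) * (c * P k j + e * P l j)^* =
    a * c^* + b * e^*.
  transitivity (a * c^* * (\sum_j P k j * (P k j)^*) +
     a * e^* * (\sum_j P k j * (P l j)^*) + b * c^* * (\sum_j P l j * (P k j)^*) +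
     b * e^* * (\sum_j P l j * (P l j)^*)).
    rewrite !mulr_sumr -!big_split /=; apply: eq_bigr => j _.
    by rewrite rmorphD !rmorphM /=; ring.
  by rewrite !orth !eqxx (negPf kl) eq_sym (negPf kl) mulr0n mulr1n; ring.
pose z j := y1 * P k j + y2 * P l j.
have PA a j : \sum_i P a i * A i j = toC (r a) * P a j.
  have : P *m A = diag_mx sp *m P.
    by rewrite {1}defA !mulmxA mulmxV ?mul1mx // unitarymx_unit.
  by move=> /matrixP /(_ a j); rewrite mul_diag_mx !mxE rE.
have zA j : \sum_i z i * A i j = (y1 * toC (r k)) * P k j + (y2 * toC (r l)) * P l j.
  rewrite -!mulrA -!PA !mulr_sumr -big_split /=; apply: eq_bigr => i _.
  by rewrite /z; ring.
have zz : \sum_j z j * (z j)^* = y1 * y1^* + y2 * y2^* by exact: comb.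
have zAz : \sum_j (\sum_i z i * A i j) * (z j)^* =
    toC (r k) * (y1 * y1^*) + toC (r l) * (y2 * y2^*).
  rewrite (eq_bigr _ (fun j _ => congr1 ( *%R^~ _) (zA j))) comb.
  move: (toC (r k)) (toC (r l)) (y1^*) (y2^*) => a b c e; ring.
have zw : \sum_j z j * toC (w j) = 0.
  rewrite -[RHS]yu /u 2!mulr_sumr -big_split /=; apply: eq_bigr => j _; rewrite /z; ring.
(* The test vector [z] is complex while [ray] speaks of real functions. Since [B] and [w] are real,
   the real and imaginary parts of [z] are each admissible after division by [w]. *)
have real_part (g : R[i] -> R) : (g = @complex.Re R) \/ (g = @complex.Im R) ->
    \sum_i \sum_j B i j * g (z i) * g (z j) <= lam * \sum_i g (z i) ^+ 2.
  move=> gE; have := ray (fun i => g (z i) / w i).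
  have -> : \sum_i p i * (g (z i) / w i) = 0.
    transitivity (g (\sum_j z j * toC (w j))); last first.
      by rewrite zw; case: gE => ->.
    case: gE => ->; rewrite ?complex_Re_sum ?complex_Im_sum; apply: eq_bigr => i _.
      by rewrite -w2; case: (z i) => a b /=; field; rewrite wn.
    by rewrite -w2; case: (z i) => a b /=; field; rewrite wn.
  move=> /(_ erefl); congr (_ <= _).
    apply: eq_bigr => i _; apply: eq_bigr => j _; rewrite mxE -w2.
    by field; rewrite !wn.
  congr (_ * _); apply: eq_bigr => i _; rewrite -w2.
  by field; rewrite !wn.
have re := real_part _ (or_introl erefl); have im := real_part _ (or_intror erefl).
pose nrm (y : R[i]) := complex.Re y ^+ 2 + complex.Im y ^+ 2.
have nrm_ge0 y : 0 <= nrm y by rewrite addr_ge0 ?sqr_ge0.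
have nrm_gt0 y : y != 0 -> 0 < nrm y.
  move=> y0; rewrite lt_neqAle nrm_ge0 andbT eq_sym; apply: contra y0 => /eqP h.
  by have := normC_complex_sqr y; rewrite -/(nrm y) h => /eqP; rewrite -normCK expf_eq0 normr_eq0.
have Ezz : \sum_i complex.Re (z i) ^+ 2 + \sum_i complex.Im (z i) ^+ 2 = nrm y1 + nrm y2.
  apply: (@complexI R); rewrite -big_split /= rmorphD rmorph_sum /= -!normC_complex_sqr -zz.
  by apply: eq_bigr => j _; rewrite normC_complex_sqr.
have EzAz : \sum_i \sum_j B i j * complex.Re (z i) * complex.Re (z j) +
    \sum_i \sum_j B i j * complex.Im (z i) * complex.Im (z j) =
    r k * nrm y1 + r l * nrm y2.
  transitivity (complex.Re (\sum_j (\sum_i z i * A i j) * (z j)^*)); last first.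
    by rewrite zAz !normC_complex_sqr -!rmorphM -rmorphD.
  rewrite exchange_big /= [X in _ + X]exchange_big -big_split complex_Re_sum /=.
  apply: eq_bigr => j _; rewrite -big_split mulr_suml complex_Re_sum /=.
  apply: eq_bigr => i _; rewrite [A i j]mxE.
  case: (z i) (z j) => [a b] [c e]; have -> : (Complex c e)^* = Complex c (- e) by [].
  by rewrite /=; ring.
(* The two real inequalities add up to [r k * nrm y1 + r l * nrm y2 <= lam * (nrm y1 + nrm y2)],
   impossible as both eigenvalues exceed [lam] and one coefficient is nonzero. *)
have := lerD re im; rewrite EzAz -mulrDr Ezz leNgt mulrDr => /negP; apply.
case/orP: yn => yn.
  by rewrite ltr_leD ?ltr_pM2r ?nrm_gt0 // ler_wpM2r // ltW.
by rewrite ler_ltD ?ltr_pM2r ?nrm_gt0 // ler_wpM2r // ltW.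
Qed.
End Spectral.

(** * q-integers and Gaussian binomial coefficients *)

Section Gauss.
Variables (R : realFieldType) (q : R).
Hypothesis q1 : 1 < q.

Definition qn n : R := \sum_(t < n) q ^+ t.

Lemma qn0 : qn 0 = 0. Proof. by rewrite /qn big_ord0. Qed.

Lemma qnS n : qn n.+1 = 1 + q * qn n.
Proof.
rewrite /qn big_ord_recl expr0 mulr_sumr; congr (_ + _).
by apply: eq_bigr => i _; rewrite -exprS.
Qed.

Lemma qn1 : qn 1 = 1. Proof. by rewrite qnS qn0 mulr0 addr0. Qed.

Lemma qnE n : (q - 1) * qn n = q ^+ n - 1.
Proof. by rewrite subrX1. Qed.

Lemma qn_ge0 n : 0 <= qn n.
Proof. by apply: sumr_ge0 => i _; rewrite exprn_ge0 // ltW // (lt_trans ltr01). Qed.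

Lemma qnS_gt0 n : 0 < qn n.+1.
Proof. by rewrite qnS ltr_pwDl // mulr_ge0 ?qn_ge0 // ltW // (lt_trans ltr01). Qed.

Lemma qnS_neq0 n : qn n.+1 != 0.
Proof. by rewrite gt_eqF // qnS_gt0. Qed.

Lemma qn_shift n : q * qn n <= qn n.+1.
Proof. by rewrite qnS lerDr. Qed.

(** The Gaussian binomial coefficient as a product. Truncated subtraction makes a factor [qn 0 = 0]
    appear as soon as [n < k], so it vanishes there as it should. *)
Definition gauss n k : R := \prod_(t < k) (qn (n - t) / qn t.+1).

Lemma gauss0 n : gauss n 0 = 1. Proof. by rewrite /gauss big_ord0. Qed.

Lemma gaussSr n k : gauss n k.+1 * qn k.+1 = gauss n k * qn (n - k).
Proof. by rewrite /gauss big_ord_recr /= -!mulrA mulVf ?mulr1 // qnS_neq0. Qed.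

(** The q-analogue of the absorption identity for binomials; the induction cancels the nonzero
    factor [qn k.+1] between two uses of [gaussSr]. *)
Lemma gaussSS n k : gauss n.+1 k.+1 * qn k.+1 = qn n.+1 * gauss n k.
Proof.
elim: k => [|k IH]; first by rewrite gaussSr !gauss0 subn0 mulrC.
apply: (mulIf (qnS_neq0 k)); rewrite gaussSr subSS mulrAC IH -!mulrA.
by rewrite gaussSr.
Qed.

Lemma gaussSl n k : gauss n.+1 k * qn (n.+1 - k) = qn n.+1 * gauss n k.
Proof. by rewrite -gaussSr gaussSS. Qed.

Lemma gaussnn n : gauss n n = 1.
Proof.
elim: n => [|n IH]; first exact: gauss0.
by apply: (mulIf (qnS_neq0 n)); rewrite gaussSS IH mul1r mulr1.
Qed.

Lemma gauss_hyperplanes n : gauss n.+1 n = qn n.+1.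
Proof. by have := gaussSl n n; rewrite subSnn qn1 gaussnn !mulr1. Qed.

Lemma gauss1 n : gauss n 1 = qn n.
Proof. by have := gaussSr n 0; rewrite qn1 gauss0 subn0 mulr1 mul1r. Qed.

End Gauss.

(** * Counting the subspaces in an interval *)

Section Counting.
Variables (F : finFieldType) (d : nat).
Implicit Types A B C U V W : {vspace 'rV[F]_d}.

Definition seg A B (m : nat) W := [&& (A <= W)%VS, (W <= B)%VS & \dim W == m].

Lemma dim_addv_vline A (x : 'rV[F]_d) :
  x \notin A -> \dim (A + <[x]>) = (\dim A).+1.
Proof.
move=> xA; apply/eqP; rewrite eqn_leq; apply/andP; split.
  apply: leq_trans (dimv_add_leqif _ _).1 _; rewrite dim_vline.
  by case: (x != 0); lia.
rewrite (ltn_leqif (dimv_leqif_sup (addvSl A <[x]>))) subv_add subvv /=.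
by rewrite -memvE.
Qed.

Lemma card_vspace_diff A B : (A <= B)%VS ->
  #|[pred x : 'rV[F]_d | (x \in B) && (x \notin A)]| = (#|F| ^ \dim B - #|F| ^ \dim A)%N.
Proof.
move=> AB; rewrite -!card_vspace -(cardID (mem A) (mem B)).
have -> : #|[predI (mem B) & (mem A)]| = #|A|.
  apply: eq_card => x; rewrite !inE /= andbC.
  by case: (boolP (x \in A)) => //= /(subvP AB).
rewrite addKn; apply: eq_card => x; by rewrite !inE andbC.
Qed.

(** Double counting of the vectors [x] of [B] outside [A]: each spans with [A] a single cover [A +
    <[x]>], and a cover [W] arises from exactly the vectors of [W] outside [A]. *)
Lemma card_covers A B : (A <= B)%VS ->
  (#|[pred W | seg A B (\dim A).+1 W]| * (#|F| ^ (\dim A).+1 - #|F| ^ \dim A) =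
   #|F| ^ \dim B - #|F| ^ \dim A)%N.
Proof.
move=> AB; rewrite -(card_vspace_diff AB) -[RHS]sum1_card.
rewrite (partition_big (fun x => A + <[x]>)%VS (seg A B (\dim A).+1)) /=; last first.
  move=> x /andP[xB xA]; rewrite /seg addvSl subv_add AB -memvE xB /=.
  by rewrite dim_addv_vline.
rewrite -sum_nat_const; apply: eq_bigr => W /and3P[AW WB /eqP dW].
rewrite -dW -(card_vspace_diff AW) -sum1_card; apply: eq_bigl => x; rewrite !inE.
apply/andP/andP => [[xW xA]|[/andP[xB xA] /eqP<-]].
  rewrite (subvP WB) // xA; split=> //; rewrite eqEdim subv_add AW -memvE xW /=.
  by rewrite dim_addv_vline ?dW.
by rewrite (subvP (addvSr _ _)) ?memv_line.
Qed.

Variable R : realFieldType.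
Local Notation q := (#|F|%:R : R).

Lemma card_finField_gt1 : 1 < q.
Proof. by rewrite ltr1n finNzRing_gt1. Qed.

Lemma card_coversR A B : (A <= B)%VS ->
  #|[pred W | seg A B (\dim A).+1 W]|%:R = qn q (\dim B - \dim A).
Proof.
move=> AB; have := congr1 (fun n => n%:R : R) (card_covers AB).
have q1 := card_finField_gt1; have q0 : 0 < q by apply: lt_trans q1.
rewrite natrM !natrB ?leq_exp2l ?dimvS // ?finNzRing_gt1 // !natrX => h.
have k0 : (q - 1) * q ^+ \dim A != 0.
  by rewrite mulf_neq0 ?expf_neq0 ?subr_eq0 ?gt_eqF.
apply: (mulIf k0); rewrite exprS in h.
transitivity (q ^+ \dim B - q ^+ \dim A); first by rewrite -h; ring.
rewrite mulrA [qn _ _ * _]mulrC qnE // mulrBl -exprD mul1r subnK //.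
exact: dimvS.
Qed.

(** Induction on [m - \dim A], counting pairs [V <= W] with [V] a cover of [A] in two ways: each [W]
    contains [qn q k.+1] such [V], and the induction hypothesis counts the [W] above a given [V]. *)
Lemma card_seg A B m : (A <= B)%VS -> (\dim A <= m)%N ->
  #|[pred W | seg A B m W]|%:R = gauss q (\dim B - \dim A) (m - \dim A).
Proof.
move=> AB /subnKC <-; rewrite addKn; move: (m - _)%N => k {m}.
have q1 := card_finField_gt1.
elim: k A AB => [|k IH] A AB.
  rewrite addn0 gauss0; transitivity (#|pred1 A|%:R : R); last by rewrite card1.
  congr (_%:R); apply: eq_card => W; rewrite !inE.
  apply/and3P/eqP => [[AW _ /eqP dW]|->]; last by rewrite subvv.
  by have /eqP -> : A == W by rewrite eqEdim AW dW leqnn.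
apply: (mulIf (qnS_neq0 q1 k)).
transitivity (\sum_(V | seg A B (\dim A).+1 V)
    #|[pred W | seg V B (\dim A + k.+1) W]|%:R : R).
  rewrite -sum1_card natr_sum mulr_suml.
  under [RHS]eq_bigr do rewrite -sum1_card natr_sum.
  rewrite (exchange_big_dep (seg A B (\dim A + k.+1))) /=; last first.
    move=> V W /and3P[AV _ _] /and3P[VW WB dW].
    by rewrite /seg (subv_trans AV VW) WB dW.
  apply: eq_bigr => W /and3P[AW WB /eqP dW].
  rewrite mul1r -[k.+1](addKn (\dim A)) -dW -card_coversR // -sum1_card natr_sum.
  apply: eq_bigl => V; rewrite !inE /seg WB subnKC ?dimvS // eqxx /= andbT.
  case: (A <= V)%VS; rewrite //= andbC; case VW: (V <= W)%VS; rewrite ?andbF ?andbT //.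
  by rewrite (subv_trans VW WB).
rewrite (eq_bigr (fun _ => gauss q (\dim B - (\dim A).+1) k)); last first.
  by move=> V /and3P[_ VB /eqP dV]; rewrite -dV -IH // dV addSnnS.
rewrite sumr_const -[LHS]mulr_natl card_coversR //.
(* [gaussSS] needs an interval of positive length; for length 0 both sides vanish because
   [qn 0 = 0]. *)
case E: (\dim B - \dim A)%N => [|n]; last by rewrite gaussSS // subnS E.
by rewrite gaussSr // sub0n qn0 mul0r mulr0.
Qed.
End Counting.

(** * Cauchy-Schwarz and sums over an incidence relation *)

Section Sums.
Variables (R : realFieldType) (I J : finType).

(** Lagrange's identity: the double sum of the squared 2 by 2 minors is twice the defect of the
    inequality. *)
Lemma cauchy_schwarz_sum (P : pred I) (f g : I -> R) :
  (\sum_(i | P i) f i * g i) ^+ 2 <=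
  (\sum_(i | P i) f i ^+ 2) * (\sum_(i | P i) g i ^+ 2).
Proof.
have : 0 <= \sum_(i | P i) \sum_(j | P j) (f i * g j - f j * g i) ^+ 2.
  by apply: sumr_ge0 => i _; apply: sumr_ge0 => j _; apply: sqr_ge0.
set X := \sum_(i | P i) f i * g i; set Y := \sum_(i | P i) f i ^+ 2.
set Z := \sum_(i | P i) g i ^+ 2.
have -> : \sum_(i | P i) \sum_(j | P j) (f i * g j - f j * g i) ^+ 2 =
    Y * Z + Y * Z - 2 * X ^+ 2.
  transitivity (\sum_(i | P i) (f i ^+ 2 * Z + Y * g i ^+ 2 - 2 * (f i * g i) * X)).
    apply: eq_bigr => i _; rewrite /X /Y /Z !(mulr_sumr, mulr_suml) -big_split -sumrB /=.
    by apply: eq_bigr => j _; ring.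
  by rewrite sumrB big_split /= -!mulr_suml -!mulr_sumr -/X -/Y -/Z; ring.
lra.
Qed.

(** Expanding the square turns the norm of an incidence operator into a quadratic form whose
    coefficients count common neighbours. *)
Lemma sum_sqr_incidence (P : pred I) (Q : pred J) (r : I -> J -> bool) (f : I -> R) :
  \sum_(j | Q j) (\sum_(i | P i && r i j) f i) ^+ 2 =
  \sum_(i | P i) \sum_(i' | P i')
     f i * f i' * #|[pred j | [&& Q j, r i j & r i' j]]|%:R.
Proof.
under eq_bigr do rewrite expr2 big_distrlr /=.
rewrite (exchange_big_dep P) /=; last by move=> j i _ /andP[].
apply: eq_bigr => i Pi; rewrite (exchange_big_dep P) /=; last by move=> j i' _ /andP[].
apply: eq_bigr => i' Pi'; rewrite sumr_const -[LHS]mulr_natr; congr (_ * _%:R).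
by apply: eq_card => j; rewrite !inE Pi Pi' /= ?andbA.
Qed.

Lemma exchange_incidence (P : pred I) (Q : pred J) (r : I -> J -> bool)
    (f : I -> R) (g : J -> R) :
  \sum_(i | P i) f i * (\sum_(j | Q j && r i j) g j) =
  \sum_(j | Q j) g j * (\sum_(i | P i && r i j) f i).
Proof.
under eq_bigr do rewrite mulr_sumr.
rewrite (exchange_big_dep Q) /=; last by move=> i j _ /andP[].
apply: eq_bigr => j Qj; rewrite mulr_sumr; apply: eq_big => i; first by rewrite Qj.
by rewrite mulrC.
Qed.

End Sums.

(** * Up and down operators on the levels of an interval *)

Section Energy.
Variables (F : finFieldType) (d : nat) (R : realFieldType).
Variables A B : {vspace 'rV[F]_d}.
Hypothesis AB : (A <= B)%VS.
Implicit Types (U V W : {vspace 'rV[F]_d}) (f g : {vspace 'rV[F]_d} -> R).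
Local Notation q := (#|F|%:R : R).
Local Notation "[ n ]_q" := (qn q n) (format "[ n ]_q").
Local Notation a := (\dim A).
Local Notation b := (\dim B).
Let q1 : 1 < q := @card_finField_gt1 F R.

Definition lsum (m : nat) f := \sum_(U | seg A B m U) f U.
Definition lnorm (m : nat) f := \sum_(U | seg A B m U) f U ^+ 2.
(** In [up] and [down] the index is the level on which [f] lives; the target level is that of the
    argument. Neither operator is normalised by its degree. *)
Definition up (m : nat) f W := \sum_(U | seg A B m U && (U <= W)%VS) f U.
Definition down (m : nat) f U := \sum_(W | seg A B m W && (U <= W)%VS) f W.

Lemma lnorm_ge0 m f : 0 <= lnorm m f.
Proof. by apply: sumr_ge0 => U _; apply: sqr_ge0. Qed.

Lemma seg_dim m U : seg A B m U -> (a <= m <= b)%N.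
Proof. by case/and3P=> AU UB /eqP <-; rewrite !dimvS. Qed.

Lemma lnorm_out m f : (b < m)%N -> lnorm m f = 0.
Proof.
move=> bm; rewrite /lnorm big_pred0 // => U; apply/negP => /seg_dim /andP[_].
by rewrite leqNgt bm.
Qed.

Lemma card_seg_above m k U : seg A B m U -> (m <= k)%N ->
  #|[pred W | seg A B k W && (U <= W)%VS]|%:R = gauss q (b - m) (k - m).
Proof.
move=> /and3P[AU UB /eqP dU] mk; rewrite -dU -card_seg ?dU //.
congr (_%:R); apply: eq_card => W; rewrite !inE /seg.
case UW: (U <= W)%VS; rewrite ?andbT ?andbF //=.
by rewrite (subv_trans AU UW).
Qed.

Lemma card_seg_below m k W : seg A B m W -> (a <= k)%N ->
  #|[pred U | seg A B k U && (U <= W)%VS]|%:R = gauss q (m - a) (k - a).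
Proof.
move=> /and3P[AW WB /eqP dW] ak; rewrite -dW -card_seg //.
congr (_%:R); apply: eq_card => U; rewrite !inE /seg.
case UW: (U <= W)%VS; rewrite ?andbT ?andbF //=.
by rewrite (subv_trans UW WB).
Qed.

Lemma card_hyperplanes m W : seg A B m.+1 W ->
  #|[pred U | seg A B m U && (U <= W)%VS]|%:R = [m.+1 - a]_q.
Proof.
move=> Ws; case: (leqP a m) => [am|ma].
  by rewrite (card_seg_below Ws am) subSn // gauss_hyperplanes.
have /andP[am _] := seg_dim Ws.
have -> : (m.+1 - a = 0)%N by apply/eqP; rewrite subn_eq0.
rewrite qn0 eq_card0 // => U; apply/negP; rewrite inE => /andP[/seg_dim /andP[aU _] _].
by rewrite leqNgt ma in aU.
Qed.

Lemma lsum_up m k f : (a <= m)%N -> (m <= k)%N ->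
  lsum k (up m f) = gauss q (b - m) (k - m) * lsum m f.
Proof.
move=> am mk; have := exchange_incidence (seg A B m) (seg A B k) (fun U W => U <= W)%VS f
   (fun=> 1).
rewrite /lsum; under [in X in _ = X]eq_bigr do rewrite mul1r.
move=> <-; rewrite mulr_sumr; apply: eq_bigr => U Us.
by rewrite sumr_const (card_seg_above Us mk) mulrC.
Qed.

Lemma lsum_down m f : lsum m (down m.+1 f) = [m.+1 - a]_q * lsum m.+1 f.
Proof.
have := exchange_incidence (seg A B m) (seg A B m.+1) (fun U W => U <= W)%VS (fun=> 1) f.
rewrite /lsum; under [in X in X = _]eq_bigr do rewrite mul1r.
move=> ->; rewrite mulr_sumr; apply: eq_bigr => W Ws.
by rewrite sumr_const (card_hyperplanes Ws) mulrC.
Qed.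

(* Two distinct [m.+1]-dimensional spaces have a common cover iff they have a common
   hyperplane, and each is then unique: this is the commutation UD - DU = scalar. *)
Lemma card_common U V m : seg A B m.+1 U -> seg A B m.+1 V -> U != V ->
  #|[pred W | [&& seg A B m.+2 W, (U <= W)%VS & (V <= W)%VS]]| =
  #|[pred W | [&& seg A B m W, (W <= U)%VS & (W <= V)%VS]]|.
Proof.
move=> /and3P[AU UB /eqP dU] /and3P[AV VB /eqP dV] UV.
have dUV : (\dim (U + V) + \dim (U :&: V) = m.+1 + m.+1)%N.
  by rewrite dimv_sum_cap dU dV.
have sup : (m.+2 <= \dim (U + V))%N.
  rewrite -dU ltn_neqAle dimvS ?addvSl // andbT; apply: contra UV => /eqP e.
  have /eqP E : U == (U + V)%VS by rewrite eqEdim addvSl e /=.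
  by rewrite eq_sym eqEdim dU dV leqnn andbT E addvSr.
have -> : #|[pred W | [&& seg A B m.+2 W, (U <= W)%VS & (V <= W)%VS]]| =
    (\dim (U + V) == m.+2).
  case: eqP => [e|ne].
    transitivity #|pred1 (U + V)%VS|; last by rewrite card1.
  apply: eq_card => W; rewrite !inE.
    apply/and3P/eqP => [[/and3P[_ _ /eqP dW] UW VW]|->].
      by apply/eqP; rewrite eq_sym eqEdim subv_add UW VW dW e /=.
    by rewrite addvSl addvSr /seg subv_add UB VB e (subv_trans AU (addvSl _ _)) eqxx.
  rewrite eq_card0 // => W; apply/negP; rewrite inE => /and3P[/and3P[_ _ /eqP dW] UW VW].
  apply: ne; apply/eqP; rewrite eqn_leq sup andbT -dW dimvS // subv_add UW //.
have -> : (\dim (U + V) == m.+2) = (\dim (U :&: V) == m) by lia.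
have inf : (\dim (U :&: V) <= m)%N by lia.
case: eqP => [e|ne].
  symmetry; transitivity #|pred1 (U :&: V)%VS|; last by rewrite card1.
  apply: eq_card => W; rewrite !inE.
  apply/and3P/eqP => [[/and3P[_ _ /eqP dW] WU WV]|->]; last first.
    by rewrite capvSl capvSr /seg subv_cap AU AV e (subv_trans (capvSl _ _) UB) eqxx.
  by apply/eqP; rewrite eqEdim subv_cap WU WV dW e leqnn.
rewrite eq_card0 // => W; apply/negP; rewrite inE => /and3P[/and3P[_ _ /eqP dW] WU WV].
by apply: ne; apply/eqP; rewrite eqn_leq inf -dW dimvS // subv_cap WU.
Qed.

(** Both norms expand into sums over pairs of spaces of dimension [m.+1]. The off-diagonal
    coefficients agree by [card_common]; the diagonal ones are the numbers of covers and of
    hyperplanes. *)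
Lemma lnorm_up_down m f :
  lnorm m.+2 (up m.+1 f) =
  lnorm m (down m.+1 f) + ([b - m.+1]_q - [m.+1 - a]_q) * lnorm m.+1 f.
Proof.
rewrite /lnorm (sum_sqr_incidence (seg A B m.+1) (seg A B m.+2) (fun U W => U <= W)%VS).
rewrite (sum_sqr_incidence (seg A B m.+1) (seg A B m) (fun U W => W <= U)%VS).
rewrite mulr_sumr -big_split /=; apply: eq_bigr => U Us.
rewrite (bigD1 U) // [in RHS](bigD1 U) //=.
have diag1 : #|[pred W | [&& seg A B m.+2 W, (U <= W)%VS & (U <= W)%VS]]|%:R = [b - m.+1]_q.
  have := card_seg_above Us (leqnSn _); rewrite subSnn gauss1 // => <-.
  by congr (_%:R); apply: eq_card => W; rewrite !inE andbb.
have diag2 : #|[pred W | [&& seg A B m W, (W <= U)%VS & (W <= U)%VS]]|%:R = [m.+1 - a]_q.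
  rewrite -(card_hyperplanes Us).
  by congr (_%:R); apply: eq_card => W; rewrite !inE andbb.
rewrite diag1 diag2.
rewrite (eq_bigr (fun V => f U * f V *
    #|[pred W | [&& seg A B m W, (W <= U)%VS & (W <= V)%VS]]|%:R)).
  ring.
by move=> V /andP[Vs VU]; rewrite card_common // eq_sym.
Qed.

Lemma lnorm_dual m mu : 0 <= mu ->
  (forall f, lsum m f = 0 -> lnorm m.+1 (up m f) <= mu * lnorm m f) ->
  forall g, lsum m.+1 g = 0 -> lnorm m (down m.+1 g) <= mu * lnorm m.+1 g.
Proof.
move=> mu0 hup g g0; set N := lnorm m _.
have [->|Npos] := eqVneq N 0; first by rewrite mulr_ge0 ?lnorm_ge0.
have {}Npos : 0 < N by rewrite lt_neqAle eq_sym Npos lnorm_ge0.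
rewrite -(ler_pM2r Npos) mulrAC.
have E : N = \sum_(U | seg A B m.+1 U) g U * up m (down m.+1 g) U.
  rewrite /N /lnorm /up -(exchange_incidence _ _ (fun U W => U <= W)%VS).
  by apply: eq_bigr => U _; rewrite expr2.
have := cauchy_schwarz_sum (seg A B m.+1) g (up m (down m.+1 g)).
rewrite -E expr2 => /le_trans; apply.
rewrite [leLHS]mulrC ler_wpM2r ?(lnorm_ge0 m.+1 g) //; apply: hup.
by rewrite lsum_down g0 mulr0.
Qed.

(** Induction on the level: [lnorm_up_down] trades going up for going down, and [lnorm_dual] bounds
    going down by the previous case. On the bottom level, which consists of [A] alone, mean zero
    means [f A = 0]. *)
Lemma up_gap m f : (a <= m)%N -> lsum m f = 0 ->
  lnorm m.+1 (up m f) <= q * [m - a]_q * [b - m.+1]_q * lnorm m f.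
Proof.
move=> am; rewrite -(subnKC am) addKn; move: (m - a)%N => {m am} k.
elim: k f => [|k IH] f f0.
  rewrite addn0 in f0 *; rewrite qn0 mulr0 !mul0r /lnorm big1 // => W Ws.
  suff -> : up a f W = 0 by rewrite expr0n.
  rewrite -f0; apply: eq_bigl => U.
  case Us: (seg A B a U) => //=.
  case/and3P: Us => AU _ /eqP dU; have /eqP <- : A == U by rewrite eqEdim AU dU leqnn.
  by case/and3P: Ws.
rewrite addnS in f0 *.
(* In the first case the target level lies above [B] and is empty. In the second, [b - (a + k).+1]
   is a successor, as the recursion for [qn] requires. *)
case: (ltnP b (a + k).+2) => [bk|kb].
  rewrite lnorm_out // !mulr_ge0 ?lnorm_ge0 ?qn_ge0 // ltW // (lt_trans ltr01) //.
rewrite lnorm_up_down.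
have mu0 : 0 <= q * [a + k - a]_q * [b - (a + k).+1]_q.
  by rewrite !mulr_ge0 ?qn_ge0 // ltW // (lt_trans ltr01).
rewrite -[X in [X]_q](addKn a) in IH.
apply: (le_trans (lerD (lnorm_dual mu0 IH f0) (lexx _))).
rewrite -mulrDl ler_wpM2r ?lnorm_ge0 //.
have [y yE] : exists y, (b - (a + k).+1 = y.+1)%N by exists (b - (a + k).+2)%N; lia.
have -> : (b - (a + k).+2 = y)%N by lia.
have -> : ((a + k).+1 - a = k.+1)%N by lia.
(* With [n+1] = 1 + q[n] the constants match exactly: q[k][y+1] + [y+1] - [k+1] = q[k+1][y]. *)
by rewrite yE ?addKn !qnS; lra.
Qed.

(** The product of q-integers is the product of the two degrees of the one-step inclusion graph, so
    the normalised operator contracts mean-zero functions by q^(-1/2). It follows from [up_gap] by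
    applying q[n] <= [n+1] to both factors. *)
Lemma up_gap_normalized m f : (a <= m)%N -> lsum m f = 0 ->
  lnorm m.+1 (up m f) <= q^-1 * ([m.+1 - a]_q * [b - m]_q) * lnorm m f.
Proof.
move=> am f0; have q0 : 0 < q by apply: lt_trans q1.
case: (ltnP b m.+1) => [bm|mb].
  rewrite lnorm_out // !mulr_ge0 ?lnorm_ge0 ?qn_ge0 // ?invr_ge0 ltW //.
apply: le_trans (up_gap am f0) _; rewrite ler_wpM2r ?lnorm_ge0 //.
rewrite -(ler_pM2l q0) [leRHS]mulrA mulfV ?gt_eqF // mul1r.
have -> : (m.+1 - a = (m - a).+1)%N by lia.
have -> : (b - m = (b - m.+1).+1)%N by lia.
have -> : q * (q * [m - a]_q * [b - m.+1]_q) = (q * [m - a]_q) * (q * [b - m.+1]_q) by ring.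
by rewrite ler_pM ?qn_shift // mulr_ge0 ?qn_ge0 // ltW.
Qed.

(** Each [U <= W] is reached through the [k]-dimensional spaces between [U] and [W], the hyperplanes
    of [W] containing [U]; their number does not depend on [U]. *)
Lemma up_up m k f W : (m <= k)%N -> seg A B k.+1 W ->
  up k (up m f) W = [k.+1 - m]_q * up m f W.
Proof.
move=> mk Ws; rewrite /up mulr_sumr.
rewrite (exchange_big_dep (fun U => seg A B m U && (U <= W)%VS)) /=; last first.
  by move=> V U /andP[/and3P[_ _ _] VW] /andP[-> UV]; rewrite (subv_trans UV).
apply: eq_bigr => U /andP[/and3P[AU UB /eqP dU] UW]; rewrite sumr_const mulrC -[LHS]mulr_natr.
congr (_ * _); case/and3P: Ws => AW WB /eqP dW.
have -> : [k.+1 - m]_q = gauss q (\dim W - \dim U) (k - \dim U).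
  by rewrite dW dU subSn // gauss_hyperplanes.
rewrite -card_seg // ?dU //; congr (_%:R); apply: eq_card => V; rewrite !inE /seg AU UB dU eqxx /=.
rewrite unfold_in /=; case UV: (U <= V)%VS; rewrite ?andbF ?andbT // (subv_trans AU UV) /= andbC.
by case VW: (V <= W)%VS; rewrite //= (subv_trans VW WB).
Qed.

Lemma gauss_ge0 n k : 0 <= gauss q n k.
Proof. by apply: prodr_ge0 => i _; rewrite divr_ge0 ?qn_ge0. Qed.

(* Up to the factor [k.+1 - m]_q, going up from level [m] to [k.+1] factors through level [k]
   ([up_up]), so the one-step gaps multiply. *)
Lemma up_multi_gap m k f : (a <= m)%N -> (m <= k)%N -> lsum m f = 0 ->
  lnorm k (up m f) <=
  q^-1 ^+ (k - m) * (gauss q (b - m) (k - m) * gauss q (k - a) (m - a)) * lnorm m f.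
Proof.
move=> am /subnKC <-; rewrite addKn => f0; elim: (k - m)%N => {k} [|k IH].
  rewrite expr0 gauss0 addn0 gaussnn // !mul1r le_eqVlt; apply/orP; left; apply/eqP.
  apply: eq_bigr => W Ws; congr (_ ^+ 2).
  rewrite /up (big_pred1 W) // => U.
  apply/andP/eqP => [[/and3P[AU UB /eqP dU] UW]|->]; last by rewrite Ws subvv.
  by case/and3P: Ws => _ _ /eqP dW; apply/eqP; rewrite eqEdim UW dU dW leqnn.
have q0 : 0 < q by apply: lt_trans q1.
case: (ltnP b (m + k).+1) => [bk|kb].
  rewrite addnS lnorm_out // !mulr_ge0 ?lnorm_ge0 ?gauss_ge0 //.
  by rewrite exprn_ge0 // invr_ge0 ltW.
have c0 : 0 < [k.+1]_q ^+ 2 by rewrite exprn_gt0 // qnS_gt0.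
rewrite -(ler_pM2l c0).
have -> : [k.+1]_q ^+ 2 * lnorm (m + k.+1) (up m f) = lnorm (m + k).+1 (up (m + k) (up m f)).
  rewrite addnS /lnorm mulr_sumr; apply: eq_bigr => W Ws.
  rewrite up_up ?leq_addr // exprMn; congr (_ ^+ 2 * _); congr (qn _ _); lia.
apply: le_trans (up_gap_normalized _ _) _; rewrite ?(leq_trans am) ?leq_addr //.
  by rewrite lsum_up ?leq_addr // f0 mulr0.
(* The degrees of the new step are absorbed into the Gaussian binomials, each absorption costing one
   factor [[k.+1]_q]; together they use up the square by which both sides were multiplied. *)
have e1 := gaussSr q1 (b - m) k.
have e2 := gaussSl q1 (m + k - a) (m - a).
rewrite -!subSn ?(leq_trans am) ?leq_addr // in e2.
have h : ((m + k).+1 - a - (m - a) = k.+1)%N by lia.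
rewrite h -subnDA in e1 e2 *; rewrite addnS.
set x := gauss _ _ k.+1 in e1 *; set y := gauss _ ((m + k).+1 - a) _ in e2 *.
have -> : [k.+1]_q ^+ 2 * (q^-1 ^+ k.+1 * (x * y) * lnorm m f) =
   q^-1 ^+ k.+1 * ((x * [k.+1]_q) * (y * [k.+1]_q)) * lnorm m f by ring.
rewrite e1 e2.
apply: (le_trans (ler_wpM2l _ IH)).
  by rewrite !mulr_ge0 ?qn_ge0 // invr_ge0 ltW.
by rewrite exprS; lra.
Qed.

(** The Gaussian binomials are the degrees of the two sides of the inclusion graph between levels
    [m] and [k]; this is the form used for a pair of colours. *)
Lemma incidence_form_bound m k f g : (a <= m)%N -> (m <= k)%N -> lsum m f = 0 ->
  (\sum_(W | seg A B k W) g W * up m f W) ^+ 2 <=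
  q^-1 ^+ (k - m) * (gauss q (b - m) (k - m) * gauss q (k - a) (m - a)) *
    (lnorm m f * lnorm k g).
Proof.
move=> am mk f0; apply: le_trans (cauchy_schwarz_sum _ _ _) _.
rewrite -/(lnorm k g) -/(lnorm k (up m f)) mulrA [leRHS]mulrC.
by rewrite ler_wpM2l ?lnorm_ge0 // up_multi_gap.
Qed.

End Energy.

(** * A Schur test for multipartite quadratic forms *)

Section QuadraticForm.
Variables (R : realFieldType) (I T : finType) (C : {set I}) (X : I -> pred T).
Variables (w1 : T -> R) (w2 : T -> T -> R) (N : R) (rho : I -> I -> R) (kappa : R).
Hypothesis N0 : 0 < N.
Hypothesis w1_ge0 : forall u, 0 <= w1 u.
Hypothesis w1_sum : forall i, i \in C -> \sum_(u | X i u) w1 u = N.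
Hypothesis w2C : forall u v, w2 u v = w2 v u.
Hypothesis w2_sum : forall i j u, i \in C -> j \in C -> i != j -> X i u ->
  \sum_(v | X j v) w2 u v = w1 u.
Hypothesis rho_ge0 : forall i j, 0 <= rho i j.
Hypothesis rhoC : forall i j, rho i j = rho j i.
Hypothesis kappa_ge0 : 0 <= kappa.
Hypothesis rho_sum : forall i, i \in C -> \sum_(j in C | j != i) rho i j <= kappa.
Hypothesis block_bound : forall i j (f g : T -> R), i \in C -> j \in C -> i != j ->
  \sum_(u | X i u) w1 u * f u = 0 -> \sum_(v | X j v) w1 v * g v = 0 ->
  (\sum_(u | X i u) \sum_(v | X j v) w2 u v * (f u * g v)) ^+ 2 <=
    rho i j ^+ 2 * ((\sum_(u | X i u) w1 u * f u ^+ 2) *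
                    (\sum_(v | X j v) w1 v * g v ^+ 2)).

Lemma le_mean_of_sqr (x r y z : R) : 0 <= r -> 0 <= y -> 0 <= z ->
  x ^+ 2 <= r ^+ 2 * (y * z) -> x <= r * ((y + z) / 2).
Proof.
move=> r0 y0 z0 h; have m0 : 0 <= r * ((y + z) / 2).
  by rewrite mulr_ge0 // divr_ge0 // addr_ge0.
rewrite (le_trans (ler_norm _)) // -(ger0_norm m0) -ler_sqr ?nnegrE ?normr_ge0 //.
rewrite !real_normK ?num_real // (le_trans h) // exprMn ler_wpM2l ?sqr_ge0 //.
by have := sqr_ge0 (y - z); lra.
Qed.

(** On each colour [f] splits into its mean [c i] and a part [g i] of mean zero. Mixed terms vanish
    because [w2] has marginals [w1]. The means contribute a nonpositive amount, and the parts [g i]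
    are controlled by [block_bound] and the row sums of [rho]. *)
Lemma quadratic_form_bound (f : T -> R) :
  \sum_(i in C) \sum_(u | X i u) w1 u * f u = 0 ->
  \sum_(i in C) \sum_(j in C | j != i) \sum_(u | X i u) \sum_(v | X j v)
     w2 u v * (f u * f v) <=
  kappa * \sum_(i in C) \sum_(u | X i u) w1 u * f u ^+ 2.
Proof.
move=> f0; have Nn : N != 0 by rewrite gt_eqF.
pose c i := (\sum_(u | X i u) w1 u * f u) / N.
pose g i u := f u - c i.
pose G i := \sum_(u | X i u) w1 u * g i u ^+ 2.
have G0 i : 0 <= G i by apply: sumr_ge0 => u _; rewrite mulr_ge0 ?sqr_ge0.
have sumg i : i \in C -> \sum_(u | X i u) w1 u * g i u = 0.
  move=> iC; under eq_bigr do rewrite mulrBr.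
  by rewrite sumrB -mulr_suml w1_sum // mulrC mulfVK // subrr.
have sum_c : \sum_(i in C) c i = 0 by rewrite -mulr_suml f0 mul0r.
have fG i : i \in C -> \sum_(u | X i u) w1 u * f u ^+ 2 = G i + N * c i ^+ 2.
  move=> iC; rewrite -(w1_sum iC) mulr_suml.
  transitivity (G i + \sum_(u | X i u) w1 u * c i ^+ 2 +
     2 * c i * \sum_(u | X i u) w1 u * g i u); last by rewrite sumg // mulr0 addr0.
  rewrite mulr_sumr -!big_split /=; apply: eq_bigr => u _.
  by rewrite /g; ring.
have block i j : i \in C -> j \in C -> i != j ->
    \sum_(u | X i u) \sum_(v | X j v) w2 u v * (f u * f v) <=
    rho i j * ((G i + G j) / 2) + N * (c i * c j).
  move=> iC jC ij.
  have -> : \sum_(u | X i u) \sum_(v | X j v) w2 u v * (f u * f v) =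
     \sum_(u | X i u) \sum_(v | X j v) w2 u v * (g i u * g j v) + N * (c i * c j).
    have e1 : \sum_(u | X i u) \sum_(v | X j v) w2 u v * (g i u * c j) = 0.
      transitivity (\sum_(u | X i u) (w1 u * g i u) * c j); last first.
        by rewrite -mulr_suml sumg // mul0r.
      apply: eq_bigr => u Xu; rewrite -mulr_suml (w2_sum iC jC ij Xu); ring.
    have e2 : \sum_(u | X i u) \sum_(v | X j v) w2 u v * (c i * g j v) = 0.
      rewrite exchange_big /=.
      transitivity (\sum_(v | X j v) (w1 v * g j v) * c i); last first.
        by rewrite -mulr_suml sumg // mul0r.
      apply: eq_bigr => v Xv; rewrite -mulr_suml.
      under eq_bigr do rewrite w2C.
      by rewrite (w2_sum jC iC) // 1?eq_sym //; ring.
    have e3 : \sum_(u | X i u) \sum_(v | X j v) w2 u v * (c i * c j) = N * (c i * c j).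
      rewrite -(w1_sum iC) mulr_suml; apply: eq_bigr => u Xu.
      by rewrite -mulr_suml (w2_sum iC jC ij Xu).
    transitivity (\sum_(u | X i u) \sum_(v | X j v) w2 u v * (g i u * g j v) +
      \sum_(u | X i u) \sum_(v | X j v) w2 u v * (g i u * c j) +
      \sum_(u | X i u) \sum_(v | X j v) w2 u v * (c i * g j v) +
      \sum_(u | X i u) \sum_(v | X j v) w2 u v * (c i * c j)).
      rewrite -!big_split /=; apply: eq_bigr => u _.
      by rewrite -!big_split /=; apply: eq_bigr => v _; rewrite /g; ring.
    by rewrite e1 e2 e3 !addr0.
  rewrite lerD2r; apply: le_mean_of_sqr => //.
  exact: block_bound iC jC ij (sumg i iC) (sumg j jC).
(* As the means add up to zero, those of the other colours sum to [- c i]; this is the source of the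
   negative sign. *)
have sumc i : i \in C -> \sum_(j in C | j != i) N * (c i * c j) = - (N * c i ^+ 2).
  move=> iC; have := sum_c; rewrite (bigD1 i) //= => /eqP.
  rewrite addrC addr_eq0 => /eqP h; rewrite -mulr_sumr -mulr_sumr h; ring.
(* The Schur test: by symmetry of [rho], averaging [G i] and [G j] over ordered pairs amounts to
   weighting each [G i] by its row sum. *)
have sumG : \sum_(i in C) \sum_(j in C | j != i) rho i j * ((G i + G j) / 2) =
    \sum_(i in C) G i * \sum_(j in C | j != i) rho i j.
  set H := RHS.
  have h1 : \sum_(i in C) \sum_(j in C | j != i) rho i j * G i = H.
    by apply: eq_bigr => i _; rewrite mulr_sumr; apply: eq_bigr => j _; rewrite mulrC.
  have h2 : \sum_(i in C) \sum_(j in C | j != i) rho i j * G j = H.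
    rewrite -h1 (exchange_big_dep (mem C)) /=; last by move=> i j _ /andP[].
    apply: eq_bigr => i iC; apply: eq_big => [j|j _]; last by rewrite rhoC.
    by rewrite iC eq_sym.
  transitivity ((H + H) / 2); last by field.
  rewrite -{1}h1 -h2 -big_split mulr_suml /=; apply: eq_bigr => i _.
  by rewrite -big_split mulr_suml /=; apply: eq_bigr => j _; ring.
apply: (@le_trans _ _ (\sum_(i in C) (G i * \sum_(j in C | j != i) rho i j - N * c i ^+ 2))).
  rewrite sumrB -sumG -sumrN -big_split /=; apply: ler_sum => i iC.
  rewrite -sumc // -big_split /=; apply: ler_sum => j /andP[jC ji].
  by apply: block; rewrite // eq_sym.
rewrite mulr_sumr; apply: ler_sum => i iC; rewrite fG //.
have h1 : G i * \sum_(j in C | j != i) rho i j <= kappa * G i.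
  by rewrite mulrC ler_wpM2r ?rho_sum.
have h2 : 0 <= N * c i ^+ 2 by rewrite mulr_ge0 ?sqr_ge0 // ltW.
have h3 : 0 <= kappa * (N * c i ^+ 2) by rewrite mulr_ge0.
by rewrite mulrDr; lra.
Qed.

End QuadraticForm.

(** * Row sums of a geometric kernel in the distance of colours *)

Definition gap (i j : nat) : nat := (i - j) + (j - i).

Lemma gap_gt0 i j : i != j -> (0 < gap i j)%N.
Proof. by rewrite /gap; lia. Qed.

Lemma gapC i j : gap i j = gap j i. Proof. by rewrite /gap addnC. Qed.

Section GeometricRows.
Variables (R : realFieldType) (r t : R).
Hypothesis r_ge0 : 0 <= r.
Hypothesis rt : r * (1 + t) = t.
Hypothesis t_ge0 : 0 <= t.

(** [rt] says that [t] is the total r + r^2 + ... of the geometric series; peeling off the first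
    term reproduces this equation. *)
Lemma sum_geometric_le n : \sum_(j < n) r ^+ j.+1 <= t.
Proof.
elim: n => [|n IH]; first by rewrite big_ord0.
rewrite big_ord_recl expr1 (eq_bigr (fun j : 'I_n => r * r ^+ j.+1)); last first.
  by move=> j _; rewrite -exprS.
rewrite -mulr_sumr -[leRHS]rt mulrDr mulr1 lerD2l; exact: ler_wpM2l.
Qed.

(** Each distance from [i] is attained at most twice, once on each side, so a row is dominated by
    two geometric series. *)
Lemma sum_gap_le d (C : {set 'I_d}) (i : 'I_d) :
  \sum_(j in C | j != i) r ^+ gap i j <= 2 * t.
Proof.
apply: (@le_trans _ _ (\sum_(j < d | j != i) r ^+ gap i j)).
  rewrite big_mkcond [leRHS]big_mkcond; apply: ler_sum => j _.
  by case: (j \in C); case: (j != i); rewrite //= exprn_ge0.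
rewrite -(big_mkord (fun j => j != i) (fun j => r ^+ gap i j)).
rewrite (@big_cat_nat _ _ _ i) //= ?(ltnW (ltn_ord i)) // mulr_natl mulr2n; apply: lerD.
  apply: le_trans (sum_geometric_le i); rewrite -(big_mkord predT (fun j => r ^+ j.+1)).
  (* Reversing the range below [i] makes the distance increase with the index, as in
     [sum_geometric_le]. *)
  rewrite big_nat_rev /= big_nat_cond [leRHS]big_nat_cond le_eqVlt; apply/orP; left.
  apply/eqP; apply: eq_big => [j|j /andP[/andP[_ ji] _]]; last by congr (r ^+ _); rewrite /gap; lia.
  by case: (ltnP j i) => //= ji; apply/eqP; lia.
rewrite big_ltn_cond // eqxx /= -{1}[i.+1]add0n big_addn.
apply: le_trans (sum_geometric_le (d - i.+1)); rewrite big_mkord.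
rewrite le_eqVlt; apply/orP; left; apply/eqP.
by apply: eq_big => [j|j _]; [apply/eqP; lia | congr (r ^+ _); rewrite /gap; lia].
Qed.
End GeometricRows.

(** * Chains of subspaces and the top faces through them *)

Section Chains.
Variables (F : finFieldType) (d : nat).
Implicit Types (U V W : {vspace 'rV[F]_d}) (c s T : {set {vspace 'rV[F]_d}}).

Lemma chainbP c :
  reflect {in c &, forall U W, (U <= W)%VS || (W <= U)%VS} (chainb c).
Proof.
apply: (iffP 'forall_in_'forall_in_idP) => h U W Uc Wc; exact: h.
Qed.

Lemma chain_dim_le c U W : chainb c -> U \in c -> W \in c ->
  (\dim U <= \dim W)%N -> (U <= W)%VS.
Proof.
move=> /chainbP ch Uc Wc UW; case/orP: (ch _ _ Uc Wc) => // WU.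
by have /eqP -> : W == U by rewrite eqEdim WU UW.
Qed.

Lemma chain_dim_inj c : chainb c -> {in c &, injective (fun U => \dim U)}.
Proof.
move=> ch U W Uc Wc /= e; apply/eqP.
by rewrite eqEdim (chain_dim_le ch) ?e /=.
Qed.

Lemma chain_sub c s : s \subset c -> chainb c -> chainb s.
Proof.
move=> /subsetP sc /chainbP ch; apply/chainbP => U W Us Ws.
by apply: ch; apply: sc.
Qed.

Lemma chainU1P c W : chainb c ->
  reflect {in c, forall V, (V <= W)%VS || (W <= V)%VS} (chainb (W |: c)).
Proof.
move=> /chainbP ch; apply: (iffP (chainbP _)) => h.
  by move=> V Vc; apply: h; rewrite !inE ?Vc ?eqxx ?orbT.
move=> U V /setU1P[->|Uc] /setU1P[->|Vc]; first by rewrite subvv.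
- by rewrite orbC; apply: h.
- exact: h.
- exact: ch.
Qed.

(** Colours lie in ['I_d], so a member equal to the whole space would leave no trace; hence the side
    conditions [\dim W < d] in later lemmas. *)
Definition colour_set c : {set 'I_d} := [set i : 'I_d | [exists W in c, \dim W == val i]].

Lemma colour_setP c (i : 'I_d) :
  reflect (exists2 W, W \in c & \dim W = val i) (i \in colour_set c).
Proof.
rewrite inE; apply: (iffP exists_inP) => -[W Wc /eqP dW]; exists W => //.
Qed.

Lemma colour_setU1 c W (i : 'I_d) : \dim W = val i ->
  colour_set (W |: c) = i |: colour_set c.
Proof.
move=> dW; apply/setP => j; rewrite !inE; apply/exists_inP/orP.
  move=> [V /setU1P[->|Vc] /eqP dV]; [left|right].
    by apply/eqP/val_inj; rewrite -dV -dW.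
  by apply/exists_inP; exists V; rewrite ?dV.
case=> [/eqP->|/exists_inP[V Vc dV]]; first by exists W; rewrite ?setU11 ?dW.
by exists V; rewrite ?setU1r.
Qed.

(* When [c] is a chain these are its largest member of dimension [< i] and its smallest one of
   dimension [> i] ([0] and the full space if there is none). *)
Definition below c (i : nat) : {vspace 'rV[F]_d} := (\sum_(W in c | (\dim W < i)%N) W)%VS.
Definition above c (i : nat) : {vspace 'rV[F]_d} := (\bigcap_(W in c | (i < \dim W)%N) W)%VS.

(** The sum of two members of a chain is the larger one, so being 0 or a member of dimension less
    than [i] survives the iterated sum. *)
Lemma below_cases c i : chainb c ->
  below c i = 0%VS \/ (below c i \in c /\ (\dim (below c i) < i)%N).
Proof.
move=> ch; rewrite /below; apply: (big_ind (fun X : {vspace 'rV[F]_d} =>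
  X = 0%VS \/ (X \in c /\ (\dim X < i)%N))).
- by left.
- move=> X Y [->|[Xc dX]]; first by rewrite add0v.
  move=> [->|[Yc dY]]; first by rewrite addv0; right.
  right; have /orP[XY|YX] := chainbP _ ch _ _ Xc Yc.
    by rewrite (addv_idPr XY).
  by rewrite (addv_idPl YX).
- by move=> X /andP[Xc dX]; right.
Qed.

Lemma above_cases c i : chainb c ->
  above c i = fullv \/ (above c i \in c /\ (i < \dim (above c i))%N).
Proof.
move=> ch; rewrite /above; apply: (big_ind (fun X : {vspace 'rV[F]_d} =>
  X = fullv \/ (X \in c /\ (i < \dim X)%N))).
- by left.
- move=> X Y [->|[Xc dX]]; first by rewrite capfv.
  move=> [->|[Yc dY]]; first by rewrite capvf; right.
  right; have /orP[XY|YX] := chainbP _ ch _ _ Xc Yc.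
    by rewrite (capv_idPl XY).
  by rewrite (capv_idPr YX).
- by move=> X /andP[Xc dX]; right.
Qed.

Lemma sub_below c i W : W \in c -> (\dim W < i)%N -> (W <= below c i)%VS.
Proof. by move=> Wc dW; rewrite /below (sumv_sup W) ?Wc. Qed.

Lemma above_sub c i W : W \in c -> (i < \dim W)%N -> (above c i <= W)%VS.
Proof. by move=> Wc dW; rewrite /above (bigcapv_inf W) ?Wc. Qed.

Lemma below_sub_above c i j : (i <= j)%N -> chainb c -> (below c i <= above c j)%VS.
Proof.
move=> ij ch; case: (below_cases i ch) => [->|[bc db]]; first exact: sub0v.
case: (above_cases j ch) => [->|[ac da]]; first exact: subvf.
by apply: (chain_dim_le ch) => //; lia.
Qed.

(** The colour of [below c i] is carried by some member of [c'], which lies in [below c' i]. For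
    equal colour sets the two inequalities give equal dimensions. *)
Lemma dim_below_le c c' i : chainb c -> chainb c' -> colour_set c \subset colour_set c' ->
  (i <= d)%N -> (\dim (below c i) <= \dim (below c' i))%N.
Proof.
move=> ch ch' /subsetP cc id; case: (below_cases i ch) => [->|[bc db]]; first by rewrite dimv0.
have bd : (\dim (below c i) < d)%N by exact: leq_trans id.
have /cc /colour_setP[W Wc dW] : Ordinal bd \in colour_set c.
  by apply/colour_setP; exists (below c i).
by rewrite -[leqLHS]dW dimvS // sub_below ?dW.
Qed.

Lemma dim_above_le c c' i : chainb c -> chainb c' -> colour_set c \subset colour_set c' ->
  (forall W, W \in c -> (\dim W < d)%N) -> (\dim (above c' i) <= \dim (above c i))%N.
Proof.
move=> ch ch' /subsetP cc cd; case: (above_cases i ch) => [->|[ac da]].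
  exact: dimvS (subvf _).
have /cc /colour_setP[W Wc dW] : Ordinal (cd _ ac) \in colour_set c.
  by apply/colour_setP; exists (above c i).
by rewrite -[leqRHS]dW dimvS // above_sub ?dW.
Qed.

Definition ext c (i : nat) W := (\dim W == i) && chainb (W |: c).

(** A space of dimension [i] is comparable with the whole chain exactly when it contains the smaller
    members and lies in the larger ones; no member has dimension [i]. *)
Lemma ext_seg c (i : 'I_d) W : chainb c -> i \notin colour_set c ->
  ext c i W = seg (below c i) (above c i) i W.
Proof.
move=> ch ic; rewrite /ext /seg; case: eqP => dW; last by rewrite !andbF.
rewrite andbT /=; apply/chainU1P/andP => // [h|[lo hi] V Vc].
  split.
    apply/subv_sumP => V /andP[Vc dV]; have := h _ Vc.
    by case/orP => // /dimvS; rewrite dW leqNgt dV.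
  apply/subv_bigcapP => V /andP[Vc dV]; have := h _ Vc.
  by case/orP => // /dimvS; rewrite dW leqNgt dV.
case: (ltngtP (\dim V) i) => dV.
- by rewrite (subv_trans (sub_below Vc dV) lo).
- by rewrite (subv_trans hi (above_sub Vc dV)) orbT.
- by case/negP: ic; apply/colour_setP; exists V.
Qed.

Lemma card_ext_eq c c' (i : 'I_d) : chainb c -> chainb c' ->
  (forall W, W \in c -> (\dim W < d)%N) -> (forall W, W \in c' -> (\dim W < d)%N) ->
  colour_set c = colour_set c' -> i \notin colour_set c ->
  #|ext c i| = #|ext c' i|.
Proof.
move=> ch ch' cd cd' cc ic.
have ic' : i \notin colour_set c' by rewrite -cc.
rewrite (eq_card (fun W => ext_seg W ch ic)) [RHS](eq_card (fun W => ext_seg W ch' ic')).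
have eb : \dim (below c i) = \dim (below c' i).
  by apply/eqP; rewrite eqn_leq !dim_below_le ?cc ?subxx // ltnW.
have ea : \dim (above c i) = \dim (above c' i).
  by apply/eqP; rewrite eqn_leq !dim_above_le ?cc ?subxx.
have bi : (\dim (below c i) <= i)%N.
  by case: (below_cases i ch) => [->|[_ /ltnW]] //; rewrite dimv0.
(* [card_seg] counts in a field; counting in [rat] and cancelling the injective cast gives the
   equality in [nat]. *)
have := card_seg rat (below_sub_above (leqnn i) ch) bi.
have := card_seg rat (below_sub_above (leqnn i) ch').
rewrite -eb -ea => /(_ _ bi) <- /eqP; rewrite eqr_nat => /eqP.
by [].
Qed.


Variable S : {set 'I_d}.

Lemma top_chain T : T \in tops F S -> chainb T.
Proof. by rewrite inE => /andP[]. Qed.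

Lemma top_colours T : T \in tops F S ->
  [seq \dim U | U <- enum T] =i [seq val i | i <- enum S].
Proof. by rewrite inE => /andP[_ /perm_mem]. Qed.

Lemma top_dim T W : T \in tops F S -> W \in T -> exists2 i : 'I_d, i \in S & \dim W = i.
Proof.
move=> /top_colours TS WT.
have : \dim W \in [seq \dim U | U <- enum T] by rewrite map_f ?mem_enum.
by rewrite TS => /mapP[i]; rewrite mem_enum => iS ->; exists i.
Qed.

Lemma top_dim_lt T W : T \in tops F S -> W \in T -> (\dim W < d)%N.
Proof. by move=> Tt /(top_dim Tt)[i _ ->]. Qed.

Lemma top_member T (i : 'I_d) : T \in tops F S -> i \in S ->
  exists2 W, W \in T & \dim W = i.
Proof.
move=> /top_colours TS iS.
have : val i \in [seq val i | i <- enum S] by rewrite map_f ?mem_enum.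
by rewrite -TS => /mapP[W]; rewrite mem_enum => WT ->; exists W.
Qed.

Lemma chain_top T : chainb T -> (forall W, W \in T -> (\dim W < d)%N) ->
  colour_set T = S -> T \in tops F S.
Proof.
move=> ch Td TS; rewrite inE /top_face ch /=; apply: uniq_perm.
- rewrite map_inj_in_uniq ?enum_uniq // => U W; rewrite !mem_enum => UT WT.
  exact: (chain_dim_inj ch UT WT).
- by rewrite map_inj_uniq ?enum_uniq //; apply: val_inj.
move=> k; apply/mapP/mapP => -[].
  move=> W; rewrite mem_enum => WT ->; exists (Ordinal (Td _ WT)) => //.
  by rewrite mem_enum -TS; apply/colour_setP; exists W.
move=> i; rewrite mem_enum -TS => /colour_setP[W WT dW] ->.
by exists W; rewrite ?mem_enum ?dW.
Qed.

Lemma tops_atP s T : reflect (T \in tops F S /\ s \subset T) (T \in tops_at S s).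
Proof. by rewrite [X in reflect _ X]in_set; apply: andP. Qed.

Lemma top_colour_set T : T \in tops F S -> colour_set T = S.
Proof.
move=> Tt; apply/setP => i; apply/colour_setP/idP => [[W WT dW]|iS].
  by have [j jS e] := top_dim Tt WT; have -> : i = j by apply/val_inj; rewrite -dW e.
by have [W WT dW] := top_member Tt iS; exists W.
Qed.

Lemma top_ext T s (i : 'I_d) W : T \in tops_at S s -> W \in T -> \dim W = i -> ext s i W.
Proof.
move=> /tops_atP[Tt sT] WT dW; rewrite /ext dW eqxx /=.
by apply: chain_sub (top_chain Tt); rewrite subUset sub1set WT.
Qed.

Lemma card_top_member T (i : 'I_d) : T \in tops F S -> i \in S ->
  #|[pred W | (W \in T) && (\dim W == i)]| = 1%N.
Proof.
move=> Tt iS; have [W WT dW] := top_member Tt iS.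
transitivity #|pred1 W|; last by rewrite card1.
apply: eq_card => V; rewrite !inE; apply/andP/eqP => [[VT /eqP dV]|->]; last by rewrite WT dW.
by apply: (chain_dim_inj (top_chain Tt) VT WT); rewrite /= dV.
Qed.

(** Double counting: a top face through [s] has exactly one member of colour [i], and that member is
    compatible with [s]. *)
Lemma sum_colour_tops s (i : 'I_d) (Q : pred {set {vspace 'rV[F]_d}}) : i \in S ->
  (\sum_(W | ext s i W) #|[set T in tops_at S s | Q T && (W \in T)]| =
   #|[set T in tops_at S s | Q T]|)%N.
Proof.
move=> iS; rewrite -[RHS]sum1_card.
under eq_bigr do rewrite -sum1_card.
rewrite (exchange_big_dep (mem [set T in tops_at S s | Q T])) /=; last first.
  by move=> W T _; rewrite !inE => /andP[-> /andP[->]].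
apply: eq_bigr => T; rewrite inE => /andP[Ts QT].
have [Tt sT] := tops_atP _ _ Ts.
rewrite sum1_card; transitivity #|[pred W | (W \in T) && (\dim W == i)]|;
  last exact: card_top_member.
apply: eq_card => W.
rewrite unfold_in /= in_set Ts QT inE /=.
case WT: (W \in T); rewrite ?andbF ?andbT //.
by apply/idP/eqP => [/andP[/eqP]|] //; apply: (top_ext Ts WT).
Qed.

Lemma tops_atU1 s W : [set T in tops_at S s | W \in T] = tops_at S (W |: s).
Proof. by apply/setP => T; rewrite !inE subUset sub1set -andbA [(W \in T) && _]andbC. Qed.

Lemma card_tops_at_ext s (i : 'I_d) : i \in S ->
  (\sum_(W | ext s i W) #|tops_at S (W |: s)| = #|tops_at S s|)%N.
Proof.
move=> iS; have := sum_colour_tops s xpredT iS; rewrite /=.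
under eq_bigr do rewrite tops_atU1.
move=> ->; congr #|pred_of_set _|; apply/setP => T; by rewrite inE andbT.
Qed.

(** Induction on the number of missing colours. Sorting the top faces by their member of a missing
    colour [i] gives equally many extensions of [c] and [c'] ([card_ext_eq]), all contributing the
    same number by induction. *)
Lemma card_tops_at_eq c c' : chainb c -> chainb c' ->
  (forall W, W \in c -> (\dim W < d)%N) -> (forall W, W \in c' -> (\dim W < d)%N) ->
  colour_set c = colour_set c' -> colour_set c \subset S ->
  #|tops_at S c| = #|tops_at S c'|.
Proof.
have [n] := ubnP #|S :\: colour_set c|; elim: n c c' => // n IH c c' ltn ch ch' cd cd' cc cS.
have [S0|/set0Pn[i]] := eqVneq (S :\: colour_set c) set0.
  have cE : colour_set c = S by apply/eqP; rewrite eqEsubset cS -setD_eq0 S0 eqxx.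
  (* A chain that already has all the colours is itself the only top face containing it. *)
  suff one e : chainb e -> (forall W, W \in e -> (\dim W < d)%N) -> colour_set e = S ->
      #|tops_at S e| = 1%N by rewrite !one // -cc.
  move=> che ed eS; rewrite -(cards1 e); apply: eq_card => T; rewrite !inE.
  apply/andP/eqP => [[Tt eT]|->]; last by have := chain_top che ed eS; rewrite inE.
  rewrite -/(top_face S T) in Tt; have {}Tt : T \in tops F S by rewrite inE.
  apply/eqP; rewrite eqEsubset eT andbT; apply/subsetP => W WT.
  have [i iS dW] := top_dim Tt WT; rewrite -eS in iS.
  have /colour_setP[V Ve dV] := iS.
  have VT := subsetP eT _ Ve.
  by rewrite (chain_dim_inj (top_chain Tt) WT VT) //= dW dV.
rewrite inE => /andP[ic iS].
have ic' : i \notin colour_set c' by rewrite -cc.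
rewrite -(card_tops_at_ext c iS) -(card_tops_at_ext c' iS).
have step e W : chainb e -> (forall W, W \in e -> (\dim W < d)%N) -> ext e i W ->
    [/\ chainb (W |: e), forall V, V \in W |: e -> (\dim V < d)%N &
        colour_set (W |: e) = i |: colour_set e].
  move=> che ed /andP[/eqP dW chW]; split=> //; last exact: colour_setU1.
  by move=> V /setU1P[->|/ed] //; rewrite dW.
have ltn' : (#|S :\: (i |: colour_set c)| < n)%N.
  rewrite -ltnS; apply: leq_trans ltn; rewrite ltnS; apply: proper_card; apply/properP; split.
    by apply: setDS; apply: subsetUr.
  by exists i; rewrite in_setD ?in_setU1 ?eqxx // ic iS.
have same e e' W W' : chainb e -> chainb e' ->
    (forall W, W \in e -> (\dim W < d)%N) -> (forall W, W \in e' -> (\dim W < d)%N) ->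
    colour_set e = colour_set c -> colour_set e' = colour_set c -> ext e i W -> ext e' i W' ->
    #|tops_at S (W |: e)| = #|tops_at S (W' |: e')|.
  move=> che che' ed ed' ec ec' /(step _ _ che ed)[h1 h2 h3] /(step _ _ che' ed')[h1' h2' h3'].
  apply: IH => //; rewrite ?h3 ?h3' ec ?ec' //.
  by rewrite subUset sub1set iS.
have cE := card_ext_eq ch ch' cd cd' cc ic.
case: (pickP (ext c i)) => [W0 W0c|none]; last first.
  rewrite !big_pred0 //; apply: card0_eq; rewrite -cE; exact: eq_card0.
rewrite (eq_bigr (fun=> #|tops_at S (W0 |: c)|)); last by move=> W Wc; apply: same.
rewrite [RHS](eq_bigr (fun=> #|tops_at S (W0 |: c)|)); last by move=> W Wc; apply: same.
by rewrite !sum_nat_const cE.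
Qed.
End Chains.

(** * Degrees in the link of a face *)

Section Links.
Variables (F : finFieldType) (d : nat) (S : {set 'I_d}) (s : {set {vspace 'rV[F]_d}}).
Hypothesis s_face : face S s.
Implicit Types (U V W : {vspace 'rV[F]_d}) (T : {set {vspace 'rV[F]_d}}).

(** [deg1] and [deg2] are the vertex and edge distributions of the link before normalisation, kept
    as integers so that they can be compared by counting. *)
Definition deg1 U : nat := #|[set T in tops_at S s | U \in T]|.
Definition deg2 U V : nat := #|[set T in tops_at S s | (U \in T) && (V \in T)]|.
Local Notation free i := ((i \in S) && (i \notin colour_set s)).

Lemma face_top : exists T, T \in tops_at S s.
Proof. by case/exists_inP: s_face => T Tt sT; exists T; apply/tops_atP. Qed.

Lemma face_chain : chainb s.
Proof. by have [T /tops_atP[/top_chain ch sT]] := face_top; apply: chain_sub ch. Qed.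

Lemma face_dim_lt W : W \in s -> (\dim W < d)%N.
Proof.
have [T /tops_atP[Tt /subsetP sT]] := face_top.
by move=> /sT WT; apply: top_dim_lt Tt WT.
Qed.

Lemma face_colours : colour_set s \subset S.
Proof.
have [T /tops_atP[Tt /subsetP sT]] := face_top; rewrite -(top_colour_set Tt).
by apply/subsetP => i /colour_setP[W /sT WT dW]; apply/colour_setP; exists W.
Qed.

Lemma deg2C U V : deg2 U V = deg2 V U.
Proof. by apply: eq_card => T; rewrite !inE [(U \in T) && _]andbC. Qed.

Lemma deg1E U : deg1 U = #|tops_at S (U |: s)|.
Proof. by rewrite /deg1 tops_atU1. Qed.

Lemma deg2E U V : deg2 U V = #|tops_at S (U |: (V |: s))|.
Proof.
apply: eq_card => T; rewrite [LHS]in_set [RHS]in_set [in LHS]in_set !subUset !sub1set.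
by case: (T \in _); case: (U \in T); case: (V \in T); rewrite ?andbF ?andbT.
Qed.

Lemma ext1 (i : 'I_d) U : free i -> ext s i U ->
  [/\ chainb (U |: s), forall V, V \in U |: s -> (\dim V < d)%N,
      colour_set (U |: s) = i |: colour_set s & \dim U = i].
Proof.
move=> _ /andP[/eqP dU chU]; split=> //; last exact: colour_setU1.
by move=> V /setU1P[->|/face_dim_lt] //; rewrite dU.
Qed.

Lemma deg1_const (i : 'I_d) U V : free i -> ext s i U -> ext s i V -> deg1 U = deg1 V.
Proof.
move=> fi /(ext1 fi)[h1 h2 h3 _] /(ext1 fi)[h1' h2' h3' _]; rewrite !deg1E.
apply: card_tops_at_eq; rewrite ?h3 ?h3' // subUset sub1set face_colours andbT.
by case/andP: fi.
Qed.

Definition comparable U V := (U <= V)%VS || (V <= U)%VS.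

Lemma ext2 (i j : 'I_d) U V : free i -> free j -> ext s i U -> ext s j V -> comparable U V ->
  [/\ chainb (U |: (V |: s)), forall W, W \in U |: (V |: s) -> (\dim W < d)%N &
      colour_set (U |: (V |: s)) = i |: (j |: colour_set s)].
Proof.
move=> fi fj Ui /(ext1 fj)[chV dV cV _]; have [chU _ _ dU] := ext1 fi Ui => UV.
split.
- apply/(chainU1P _ chV) => W /setU1P[->|Ws]; first by rewrite orbC.
  exact: (chainU1P _ face_chain chU).
- by move=> W /setU1P[->|/dV] //; rewrite dU.
- by rewrite (colour_setU1 _ dU) cV.
Qed.

Lemma deg2_const (i j : 'I_d) U V U' V' : free i -> free j ->
  ext s i U -> ext s j V -> comparable U V -> ext s i U' -> ext s j V' -> comparable U' V' ->
  deg2 U V = deg2 U' V'.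
Proof.
move=> fi fj Ui Vj UV Ui' Vj' UV'.
have [h1 h2 h3] := ext2 fi fj Ui Vj UV; have [h1' h2' h3'] := ext2 fi fj Ui' Vj' UV'.
rewrite !deg2E; apply: card_tops_at_eq; rewrite ?h3 ?h3' // !subUset !sub1set face_colours.
by case/andP: fi => ->; case/andP: fj => ->.
Qed.

Lemma deg2_comparable U V : (0 < deg2 U V)%N -> comparable U V.
Proof.
case/card_gt0P => T; rewrite in_set => /andP[/tops_atP[Tt _] /andP[UT VT]].
exact: (chainbP _ (top_chain Tt)).
Qed.

Lemma deg2_incomparable U V : ~~ comparable U V -> deg2 U V = 0%N.
Proof. by move=> UV; apply/eqP; rewrite -leqn0 leqNgt; apply: contra UV => /deg2_comparable. Qed.

Lemma sum_deg1 (i : 'I_d) : i \in S -> (\sum_(U | ext s i U) deg1 U = #|tops_at S s|)%N.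
Proof. by move=> iS; rewrite -(card_tops_at_ext s iS); apply: eq_bigr => U _; rewrite deg1E. Qed.

Lemma sum_deg2 (j : 'I_d) U : j \in S -> (\sum_(V | ext s j V) deg2 U V = deg1 U)%N.
Proof. by move=> jS; apply: (sum_colour_tops s (fun T => U \in T) jS). Qed.

(** Some top face contains [s], and its member of colour [i] has positive degree; the degree is
    constant on a colour. *)
Lemma ext_gt0 (i : 'I_d) U : free i -> ext s i U -> (0 < deg1 U)%N.
Proof.
move=> fi Ui; have [T Ts] := face_top; have /tops_atP[Tt _] := Ts.
have [W WT dW] := top_member Tt (proj1 (andP fi)).
rewrite (deg1_const fi Ui (top_ext Ts WT dW)); apply/card_gt0P; exists T.
by rewrite in_set Ts.
Qed.

Section Block.
Variable R : realType.
Local Notation q := (#|F|%:R : R).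
Let q1 : 1 < q := @card_finField_gt1 F R.

Lemma sum_weighted_const (X : pred {vspace 'rV[F]_d}) (n : R) (w : {vspace 'rV[F]_d} -> nat)
    (f : {vspace 'rV[F]_d} -> R) : n != 0 -> (forall U, X U -> (w U)%:R = n) ->
  \sum_(U | X U) (w U)%:R * f U = 0 -> \sum_(U | X U) f U = 0.
Proof.
move=> n0 wn; under eq_bigr => U XU do rewrite wn //.
by rewrite -mulr_sumr => /eqP; rewrite mulf_eq0 (negPf n0) => /eqP.
Qed.

(** Edges between two colours all have the same weight, so the form is a multiple of the inclusion
    form. A member of [s] strictly between the colours makes the graph complete bipartite; otherwise
    [incidence_form_bound] applies. *)
Lemma block_bound_lt (i j : 'I_d) (f g : {vspace 'rV[F]_d} -> R) : free i -> free j ->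
  (i < j)%N -> \sum_(U | ext s i U) (deg1 U)%:R * f U = 0 ->
  (\sum_(U | ext s i U) \sum_(V | ext s j V) (deg2 U V)%:R * (f U * g V)) ^+ 2 <=
  q^-1 ^+ (j - i) * ((\sum_(U | ext s i U) (deg1 U)%:R * f U ^+ 2) *
                     (\sum_(V | ext s j V) (deg1 V)%:R * g V ^+ 2)).
Proof.
move=> fi fj ij f0; have [T Ts] := face_top; have /tops_atP[Tt _] := Ts.
have q0 : 0 < q by apply: lt_trans q1.
(* A top face supplies a comparable pair, whose [deg2] is the common edge weight [n]. *)
have [U0 U0T dU0] := top_member Tt (proj1 (andP fi)).
have [V0 V0T dV0] := top_member Tt (proj1 (andP fj)).
have U0i := top_ext Ts U0T dU0; have V0j := top_ext Ts V0T dV0.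
have UV0 : comparable U0 V0 by apply: (chainbP _ (top_chain Tt)).
pose n := (deg2 U0 V0)%:R : R.
have sub U V : ext s i U -> ext s j V -> comparable U V = (U <= V)%VS.
  move=> /andP[/eqP dU _] /andP[/eqP dV _]; rewrite /comparable.
  case VU: (V <= U)%VS; last by rewrite orbF.
  by have := dimvS VU; rewrite dU dV leqNgt ij.
have deg2E' U V : ext s i U -> ext s j V -> (deg2 U V)%:R = n * (U <= V)%VS%:R.
  move=> Ui Vj; rewrite -sub //; case: (boolP (comparable U V)) => UV.
    by rewrite mulr1 /n (deg2_const fi fj Ui Vj UV U0i V0j UV0).
  by rewrite mulr0 deg2_incomparable.
have nU U : ext s i U -> (deg1 U)%:R = (deg1 U0)%:R :> R.
  by move=> Ui; rewrite (deg1_const fi Ui U0i).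
have nV V : ext s j V -> (deg1 V)%:R = (deg1 V0)%:R :> R.
  by move=> Vj; rewrite (deg1_const fj Vj V0j).
have sf : \sum_(U | ext s i U) f U = 0.
  by apply: sum_weighted_const nU f0; rewrite pnatr_eq0 -lt0n (ext_gt0 fi U0i).
have rhs_ge0 : 0 <= q^-1 ^+ (j - i) * ((\sum_(U | ext s i U) (deg1 U)%:R * f U ^+ 2) *
                     (\sum_(V | ext s j V) (deg1 V)%:R * g V ^+ 2)).
  rewrite mulr_ge0 ?exprn_ge0 ?invr_ge0 ?(ltW q0) //.
  by rewrite mulr_ge0 // sumr_ge0 // => U _; rewrite mulr_ge0 ?sqr_ge0.
case: (boolP [exists W in s, (i < \dim W < j)%N]) => [/exists_inP[W Ws /andP[iW Wj]]|nosep].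
  (* Every [U] lies in [W] and every [V] contains it, so the form is a product with the factor
     [\sum f = 0]. *)
  suff -> : \sum_(U | ext s i U) \sum_(V | ext s j V) (deg2 U V)%:R * (f U * g V) = 0.
    by rewrite expr0n.
  transitivity (\sum_(U | ext s i U) f U * (n * \sum_(V | ext s j V) g V)).
    apply: eq_bigr => U Ui; rewrite !mulr_sumr; apply: eq_bigr => V Vj.
    rewrite deg2E' //; have -> : (U <= V)%VS.
      have /andP[/eqP dU /(chainU1P _ face_chain)/(_ W Ws) WU] := Ui.
      have /andP[/eqP dV /(chainU1P _ face_chain)/(_ W Ws) WV] := Vj.
      apply: (@subv_trans _ _ W).
        by case/orP: WU => // /dimvS; rewrite dU leqNgt iW.
      by case/orP: WV => // /dimvS; rewrite dV leqNgt Wj.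
    by rewrite mulr1; ring.
  by rewrite -mulr_suml sf mul0r.
(* Without a separating member, colours [i] and [j] see the same neighbours in [s], hence are two
   levels of one interval. *)
have nocol W : W \in s -> (\dim W < j)%N = (\dim W < i)%N.
  move=> Ws; have := nosep; rewrite negb_exists => /forallP/(_ W); rewrite Ws /= => h.
  have : \dim W != i.
    by apply/eqP => e; case/andP: fi => _ /negP[]; apply/colour_setP; exists W.
  by move: h ij; clear; lia.
have nocol' W : W \in s -> (j < \dim W)%N = (i < \dim W)%N.
  move=> Ws; have := nosep; rewrite negb_exists => /forallP/(_ W); rewrite Ws /= => h.
  have : \dim W != j.
    by apply/eqP => e; case/andP: fj => _ /negP[]; apply/colour_setP; exists W.
  by move: h ij; clear; lia.
have eA : below s j = below s i.
  by apply: eq_bigl => W; case Ws: (W \in s) => //=; rewrite nocol.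
have eB : above s i = above s j.
  by apply: eq_bigl => W; case Ws: (W \in s) => //=; rewrite nocol'.
pose A := below s i; pose B := above s j.
have Xi U : ext s i U = seg A B i U.
  by rewrite (ext_seg _ face_chain) ?eB //; case/andP: fi.
have Xj U : ext s j U = seg A B j U.
  by rewrite (ext_seg _ face_chain) ?eA //; case/andP: fj.
have AB : (A <= B)%VS by apply: below_sub_above face_chain; apply: ltnW.
have ai : (\dim A <= i)%N.
  by case: (below_cases i face_chain) => [|[_ /ltnW]] //; rewrite /A => ->; rewrite dimv0.
(* Vertex weights are [n] times the degrees of the inclusion graph, so they absorb the Gaussian
   binomials of the interval bound exactly. *)
have dup : (deg1 U0)%:R = n * gauss q (\dim B - i) (j - i).
  rewrite -(sum_deg2 U0 (proj1 (andP fj))) natr_sum.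
  rewrite -(card_seg_above R (_ : seg A B i U0) (ltnW ij)) -?Xi //.
  rewrite (eq_bigr (fun V => n * (U0 <= V)%VS%:R)) => [|V Vj]; last exact: deg2E'.
  rewrite -mulr_sumr -natr_sum -big_mkcondr sum1_card; congr (_ * _%:R).
  by apply: eq_card => V; rewrite !inE unfold_in Xj.
have ddown : (deg1 V0)%:R = n * gauss q (j - \dim A) (i - \dim A).
  rewrite -(sum_deg2 V0 (proj1 (andP fi))) natr_sum.
  rewrite -(card_seg_below R (_ : seg A B j V0) ai) -?Xj //.
  rewrite (eq_bigr (fun U => n * (U <= V0)%VS%:R)) => [|U Ui]; last by rewrite deg2C deg2E'.
  rewrite -mulr_sumr -natr_sum -big_mkcondr sum1_card; congr (_ * _%:R).
  by apply: eq_card => V; rewrite !inE unfold_in Xi.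
have lsf : lsum A B i f = 0 by rewrite -sf; apply: eq_bigl => U; rewrite Xi.
have -> : \sum_(U | ext s i U) \sum_(V | ext s j V) (deg2 U V)%:R * (f U * g V) =
    n * \sum_(V | seg A B j V) g V * up A B i f V.
  rewrite -(exchange_incidence (seg A B i) (seg A B j) (fun U V => U <= V)%VS f g).
  rewrite mulr_sumr; apply: eq_big => [U|U Ui]; first by rewrite Xi.
  rewrite mulrA mulr_sumr [RHS]big_mkcondr; apply: eq_big => [V|V Vj]; first by rewrite Xj.
  by rewrite deg2E' //; case: (U <= V)%VS; rewrite ?mulr1 ?mulr0 ?mul0r // mulrA.
have -> : \sum_(U | ext s i U) (deg1 U)%:R * f U ^+ 2 = (deg1 U0)%:R * lnorm A B i f.
  by rewrite mulr_sumr; apply: eq_big => [U|U Ui]; rewrite ?Xi ?nU.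
have -> : \sum_(V | ext s j V) (deg1 V)%:R * g V ^+ 2 = (deg1 V0)%:R * lnorm A B j g.
  by rewrite mulr_sumr; apply: eq_big => [U|U Ui]; rewrite ?Xj ?nV.
rewrite exprMn dup ddown.
apply: le_trans (ler_wpM2l (sqr_ge0 n) (incidence_form_bound AB g ai (ltnW ij) lsf)) _.
by rewrite le_eqVlt; apply/orP; left; apply/eqP; ring.
Qed.

End Block.
End Links.

(** * From pairs of colours to the second eigenvalue *)

Section Graph.
Variables (R : realType) (F : finFieldType) (d : nat) (S C : {set 'I_d}).
Variable s : {set {vspace 'rV[F]_d}}.
Hypothesis s_face : face S s.
Hypothesis C_free : forall i, i \in C -> (i \in S) && (i \notin colour_set s).
Local Notation q := (#|F|%:R : R).
Local Notation r := ((Num.sqrt q)^-1).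
Let q1 : 1 < q := @card_finField_gt1 F R.

Lemma block_bound (i j : 'I_d) (f g : {vspace 'rV[F]_d} -> R) : i \in C -> j \in C -> i != j ->
  \sum_(U | ext s i U) (deg1 S s U)%:R * f U = 0 ->
  \sum_(V | ext s j V) (deg1 S s V)%:R * g V = 0 ->
  (\sum_(U | ext s i U) \sum_(V | ext s j V) (deg2 S s U V)%:R * (f U * g V)) ^+ 2 <=
  (r ^+ gap i j) ^+ 2 * ((\sum_(U | ext s i U) (deg1 S s U)%:R * f U ^+ 2) *
                         (\sum_(V | ext s j V) (deg1 S s V)%:R * g V ^+ 2)).
Proof.
move=> iC jC ij f0 g0.
have -> : (r ^+ gap i j) ^+ 2 = q^-1 ^+ gap i j.
  by rewrite exprAC exprVn sqr_sqrtr // ltW // (lt_trans ltr01).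
case: (ltngtP i j) => [lt|lt|/val_inj e]; last by rewrite e eqxx in ij.
- have -> : gap i j = (j - i)%N by rewrite /gap; lia.
  exact: (block_bound_lt s_face g (C_free iC) (C_free jC) lt f0).
have -> : gap i j = (i - j)%N by rewrite /gap; lia.
rewrite exchange_big [_ * (\sum_(V | ext s j V) _)]mulrC /=.
under eq_bigr => V _ do under eq_bigr => U _ do rewrite deg2C [f U * _]mulrC.
exact: (block_bound_lt s_face f (C_free jC) (C_free iC) lt g0).
Qed.

Lemma deg2_same_colour (i : 'I_d) U V : ext s i U -> ext s i V -> U != V -> deg2 S s U V = 0%N.
Proof.
move=> /andP[/eqP dU _] /andP[/eqP dV _] UV; apply: deg2_incomparable.
rewrite /comparable; apply: contra UV.
by case/orP => h; [rewrite eqEdim | rewrite eq_sym eqEdim]; rewrite h dU dV leqnn.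
Qed.

Lemma sum_by_colour (Vs : {set {vspace 'rV[F]_d}}) (G : {vspace 'rV[F]_d} -> R) :
  (forall U, (U \in Vs) = [exists i in C, ext s i U]) ->
  \sum_(U in Vs) G U = \sum_(i in C) \sum_(U | ext s i U) G U.
Proof.
move=> HV; rewrite (exchange_big_dep (mem Vs)) /=; last first.
  by move=> i U iC Ui; rewrite HV; apply/exists_inP; exists i.
apply: eq_bigr => U; rewrite HV => /exists_inP[i iC Ui].
rewrite (big_pred1 i) // => j; apply/andP/eqP => [[jC Uj]|->] //.
by case/andP: Ui => /eqP dU _; case/andP: Uj => /eqP dU' _; apply: val_inj; rewrite /= -dU dU'.
Qed.

(** Serves both graph families, which differ in the colours [C], the normalisation [alpha] and the
    row bound [kappa]. The matrix is reversible for the weights [deg1] because [deg2] is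
    symmetric. *)
Lemma graph_second_eig_le (Vs : {set {vspace 'rV[F]_d}}) pi0 pi1 (alpha kappa : R) :
  (forall U, (U \in Vs) = [exists i in C, ext s i U]) ->
  (forall U V, U \in Vs -> V \in Vs -> (deg1 S s U)%:R * (pi1 U V / (2 * pi0 U)) =
     alpha * (if U != V then (deg2 S s U V)%:R else 0)) ->
  0 <= alpha -> 0 <= kappa ->
  (forall i, i \in C -> \sum_(j in C | j != i) r ^+ gap i j <= kappa) ->
  second_eig_le (graph_mx Vs pi0 pi1) (alpha * kappa).
Proof.
move=> HV Hw a0 k0 hk.
have p0 U : U \in Vs -> (0 : R) < (deg1 S s U)%:R.
  by rewrite HV => /exists_inP[i iC Ui]; rewrite ltr0n (ext_gt0 s_face (C_free iC) Ui).
have pM i j : (deg1 S s (enum_val i))%:R * graph_mx Vs pi0 pi1 i j =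
    alpha * (if enum_val i != enum_val j then (deg2 S s (enum_val i) (enum_val j))%:R else 0).
  by rewrite mxE Hw ?enum_valP.
apply: (@second_eig_le_rayleigh _ _ _ (fun i => (deg1 S s (enum_val i))%:R)).
- exact: mulr_ge0.
- by move=> i; rewrite p0 ?enum_valP.
- by move=> i j; rewrite !pM eq_sym deg2C.
(* [f'] carries [f] from matrix indices to subspaces, with value 0 outside [Vs]. *)
move=> f f0; pose f' U := \sum_(i | enum_val i == U) f i.
have f'E i : f' (enum_val i) = f i.
  by rewrite /f' (big_pred1 i) // => j; rewrite (inj_eq enum_val_inj).
have sumE (G : {vspace 'rV[F]_d} -> R) : \sum_(i < #|Vs|) G (enum_val i) =
    \sum_(i in C) \sum_(U | ext s i U) G U.
  by rewrite -(sum_by_colour _ HV) [RHS]big_enum_val.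
have f'0 : \sum_(i in C) \sum_(U | ext s i U) (deg1 S s U)%:R * f' U = 0.
  by rewrite -sumE -[RHS]f0; apply: eq_bigr => i _; rewrite f'E.
have -> : \sum_i (deg1 S s (enum_val i))%:R * f i ^+ 2 =
    \sum_(i in C) \sum_(U | ext s i U) (deg1 S s U)%:R * f' U ^+ 2.
  by rewrite -sumE; apply: eq_bigr => i _; rewrite f'E.
have -> : \sum_i \sum_j (deg1 S s (enum_val i))%:R * graph_mx Vs pi0 pi1 i j * f i * f j =
    alpha * \sum_(i in C) \sum_(j in C | j != i) \sum_(U | ext s i U) \sum_(V | ext s j V)
       (deg2 S s U V)%:R * (f' U * f' V).
  pose w U V : R := if U != V then (deg2 S s U V)%:R else 0.
  transitivity (alpha * \sum_(i < #|Vs|) \sum_(j < #|Vs|) w (enum_val i) (enum_val j) *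
      (f' (enum_val i) * f' (enum_val j))).
    rewrite mulr_sumr; apply: eq_bigr => i _; rewrite mulr_sumr; apply: eq_bigr => j _.
    by rewrite pM !f'E /w !mulrA.
  rewrite (sumE (fun U => \sum_(j < #|Vs|) w U (enum_val j) * (f' U * f' (enum_val j)))).
  congr (_ * _); apply: eq_bigr => i iC.
  under eq_bigr => U _ do rewrite (sumE (fun V => w U V * (f' U * f' V))).
  (* Blocks within one colour vanish: distinct spaces of equal dimension never share a top face. *)
  rewrite exchange_big /= (bigD1 i) //= [X in X + _]big1 ?add0r; last first.
    move=> U Ui; rewrite big1 // => V Vi; rewrite /w.
    by case: eqVneq => UV; rewrite /= ?mul0r // (deg2_same_colour Ui Vi) ?mul0r.
  apply: eq_bigr => j /andP[jC ji]; apply: eq_bigr => U Ui; apply: eq_bigr => V Vj.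
  rewrite /w; case: eqVneq => // e; case/negP: ji; apply/eqP/val_inj.
  by case/andP: Ui => /eqP /= <- _; case/andP: Vj => /eqP /= <- _; rewrite e.
rewrite -mulrA; apply: ler_wpM2l => //.
have rpos : 0 <= r by rewrite invr_ge0 sqrtr_ge0.
apply: (@quadratic_form_bound _ _ _ C (fun i => ext s (nat_of_ord i)) (fun U => (deg1 S s U)%:R)
  (fun U V => (deg2 S s U V)%:R) #|tops_at S s|%:R (fun i j => r ^+ gap i j)) => //.
- by rewrite ltr0n; apply/card_gt0P; apply: face_top.
- by move=> i iC; rewrite -natr_sum sum_deg1 //; case/andP: (C_free iC).
- by move=> U V; rewrite deg2C.
- by move=> i j U iC jC ij Ui; rewrite -natr_sum sum_deg2 //; case/andP: (C_free jC).
- by move=> i j; rewrite exprn_ge0.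
- by move=> i j; rewrite gapC.
- by move=> i j g h iC jC ij; apply: block_bound.
Qed.

End Graph.

(** * Vertex sets and normalisations of the two graph families *)

Section Verts.
Variables (F : finFieldType) (d : nat) (S : {set 'I_d}) (s : {set {vspace 'rV[F]_d}}).
Hypothesis s_face : face S s.

Lemma ext_top (i : 'I_d) U : (i \in S) && (i \notin colour_set s) -> ext s i U ->
  exists2 T, T \in tops_at S s & U \in T.
Proof.
move=> fi Ui; have /card_gt0P[T] := ext_gt0 s_face fi Ui.
by rewrite in_set => /andP[Ts UT]; exists T.
Qed.

Lemma in_link_verts U :
  (U \in link_verts S s) = [exists i in S :\: colour_set s, ext s i U].
Proof.
rewrite in_set; apply/andP/exists_inP => [[Us /exists_inP[T Ts UT]]|[i]].
  have /tops_atP[Tt sT] := Ts; have [i iS dU] := top_dim Tt UT.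
  exists i; last exact: top_ext Ts UT dU.
  rewrite in_setD iS andbT; apply: contra Us => /colour_setP[W Ws dW].
  have -> // : U = W.
  by apply: (chain_dim_inj (top_chain Tt) UT (subsetP sT _ Ws)); rewrite /= dU dW.
rewrite in_setD andbC => fi Ui; split.
  case/andP: fi => _; apply: contra => Us; apply/colour_setP; exists U => //.
  by case/andP: Ui => /eqP.
by have [T Ts UT] := ext_top fi Ui; apply/exists_inP; exists T.
Qed.

Lemma in_prod_verts (i j : 'I_d) U :
  (i \in S) && (i \notin colour_set s) -> (j \in S) && (j \notin colour_set s) ->
  (U \in prod_verts S s i j) = [exists k in [set i; j], ext s k U].
Proof.
move=> fi fj; rewrite in_set; apply/andP/exists_inP => [[dU /exists_inP[T Ts UT]]|[k]].
  by case/orP: dU => /eqP dU; [exists i | exists j]; rewrite ?inE ?eqxx ?orbT //;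
    apply: top_ext Ts UT dU.
have key k' : (k' \in S) && (k' \notin colour_set s) -> ext s k' U ->
    [exists T in tops_at S s, U \in T].
  by move=> fk /(ext_top fk)[T Ts UT]; apply/exists_inP; exists T.
rewrite in_set2 => /orP[] /eqP-> Uk; split; rewrite ?(key _ _ Uk) //.
  by case/andP: Uk => ->.
by case/andP: Uk => -> _; rewrite orbT.
Qed.

End Verts.

(** With codimension k + 2, the identity 2 C(k+2, 2) = (k+2)(k+1) cancels the factor k + 2 of
    [link_pi0] and leaves 1/(k+1). *)
Lemma link_pi_ratio (R : realType) (F : finFieldType) (d : nat) (S : {set 'I_d})
    (s : {set {vspace 'rV[F]_d}}) U V :
  (#|s| + 2 <= #|S|)%N -> (0 < #|tops_at S s|)%N -> (0 < deg1 S s U)%N ->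
  (deg1 S s U)%:R * (link_pi1 R S s U V / (2 * link_pi0 R S s U)) =
  (#|S| - #|s| - 1)%N%:R^-1 * (if U != V then (deg2 S s U V)%:R else 0).
Proof.
move=> codim2 N0 d0; rewrite /link_pi1 /link_pi0 -/(deg1 S s U) -/(deg2 S s U V).
case: (U != V); last by rewrite mul0r !mulr0.
have [k kE] : exists k, codim S s = k.+2.
  by exists (#|S| - (#|s| + 2))%N; rewrite /codim -[in LHS](subnKC codim2) -addnA addKn.
rewrite -/(codim S s) kE subn1 /=.
have : 2 * 'C(k.+2, 2)%:R = k.+2%:R * k.+1%:R :> R.
  by rewrite -!natrM -mul_bin_diag bin1.
set b : R := 'C(k.+2, 2)%:R => bE.
have k2 : k.+2%:R != 0 :> R by rewrite pnatr_eq0.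
have k1 : k.+1%:R != 0 :> R by rewrite pnatr_eq0.
have bE' : b = k.+2%:R * k.+1%:R / 2 by rewrite -bE; field.
have N0' : #|tops_at S s|%:R != 0 :> R by rewrite pnatr_eq0 -lt0n.
have d0' : (deg1 S s U)%:R != 0 :> R by rewrite pnatr_eq0 -lt0n.
move: (k.+2%:R) (k.+1%:R) k2 k1 bE' => x y x0 y0 ->; by field; rewrite N0' d0' x0 y0.
Qed.

Lemma prod_pi_ratio (R : realType) (F : finFieldType) (d : nat) (S : {set 'I_d})
    (s : {set {vspace 'rV[F]_d}}) U V : (0 < #|tops_at S s|)%N -> (0 < deg1 S s U)%N ->
  (deg1 S s U)%:R * (prod_pi1 R S s U V / (2 * prod_pi0 R S s U)) =
  1 * (if U != V then (deg2 S s U V)%:R else 0).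
Proof.
move=> N0 d0; rewrite /prod_pi1 /prod_pi0 -/(deg1 S s U) -/(deg2 S s U V).
case: (U != V); last by rewrite mul0r !mulr0.
have N0' : #|tops_at S s|%:R != 0 :> R by rewrite pnatr_eq0 -lt0n.
have d0' : (deg1 S s U)%:R != 0 :> R by rewrite pnatr_eq0 -lt0n.
by field; rewrite N0' d0'.
Qed.

Theorem theorem1p3 (R : realType) (F : finFieldType) (d : nat) (S : {set 'I_d}) :
  (3 <= d)%N -> (forall i : 'I_d, i \in S -> (0 < val i)%N) -> (2 <= #|S|)%N ->
  (forall s : {set {vspace 'rV[F]_d}}, @face F d S s -> (#|s| + 2 <= #|S|)%N ->
     @second_eig_le R _ (@link_mx R F d S s)
       (2 / ((#|S| - #|s| - 1)%N%:R * (Num.sqrt (#|F|%:R : R) - 1))))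
  /\ @local_spectral_expander R F d S (2 / (Num.sqrt (#|F|%:R : R) - 1))
  /\ @lambda_product R F d S (1 / Num.sqrt (#|F|%:R : R)).
Proof.
move=> _ _ _; set sq := Num.sqrt _.
have q1 : 1 < #|F|%:R :> R := @card_finField_gt1 F R.
have sq1 : 1 < sq by rewrite -sqrtr1 ltr_sqrt // (lt_trans ltr01).
have sq0 : sq - 1 != 0 by rewrite subr_eq0 gt_eqF.
have sqn : sq != 0 by rewrite gt_eqF // (lt_trans ltr01).
have r0 : 0 <= sq^-1 by rewrite invr_ge0 ltW // (lt_trans ltr01).
have t0 : 0 <= (sq - 1)^-1 by rewrite invr_ge0 subr_ge0 ltW.
(* The geometric series of ratio [sq^-1] has total [(sq - 1)^-1]. *)
have rt : sq^-1 * (1 + (sq - 1)^-1) = (sq - 1)^-1 by field; rewrite sqn sq0.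
have tops_gt0 (s : {set {vspace 'rV[F]_d}}) : face S s -> (0 < #|tops_at S s|)%N.
  by move=> fs; apply/card_gt0P; apply: face_top.
have link (s : {set {vspace 'rV[F]_d}}) : face S s -> (#|s| + 2 <= #|S|)%N ->
    second_eig_le (link_mx R S s) (2 / ((#|S| - #|s| - 1)%N%:R * (sq - 1))).
  (* The bound is put in the form [alpha * kappa], with [alpha] the inverse of the codimension minus
     one and [kappa] twice the geometric total. *)
  move=> fs cs; rewrite invfM mulrCA.
  have Cf i : i \in S :\: colour_set s -> (i \in S) && (i \notin colour_set s).
    by rewrite in_setD andbC.
  apply: (@graph_second_eig_le R F d S (S :\: colour_set s) s) => //.
  - exact: in_link_verts.
  - move=> U V; rewrite in_link_verts // => /exists_inP[i /Cf fi Ui] _.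
    by apply: link_pi_ratio => //; [exact: tops_gt0 | exact: ext_gt0 fi Ui].
  - by rewrite invr_ge0 ler0n.
  - by rewrite mulr_ge0.
  - by move=> i _; apply: sum_gap_le.
split=> //; split.
  move=> s fs cs; have [rs [rsE rsle]] := link s fs cs; exists rs; split=> //.
  apply: le_trans rsle _; rewrite ler_wpM2l // invfM -[leRHS]mul1r ler_wpM2r //.
  by rewrite invf_le1 ?ltr0n ?ler1n; lia.
move=> s fs cs i j iS jS ij is_ js.
have free (k : 'I_d) : k \in S -> val k \notin colors s -> (k \in S) && (k \notin colour_set s).
  move=> -> /=; apply: contra => /colour_setP[W Ws dW].
  by apply/mapP; exists W; rewrite ?mem_enum.
have fi := free i iS is_; have fj := free j jS js.
(* With two colours [alpha] is 1 and each row of the kernel has a single entry, a positive power of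
   [sq^-1], so [kappa] is [sq^-1]. *)
rewrite mul1r -[sq^-1]mul1r.
have Cf k : k \in [set i; j] -> (k \in S) && (k \notin colour_set s).
  by rewrite in_set2 => /orP[] /eqP ->.
rewrite /prod_mx; apply: (@graph_second_eig_le R F d S [set i; j] s) => //.
- by move=> U; apply: in_prod_verts.
- move=> U V; rewrite in_prod_verts // => /exists_inP[k /Cf fk Uk] _.
  by apply: prod_pi_ratio; [exact: tops_gt0 | exact: ext_gt0 fk Uk].
have rle (k l : 'I_d) : k != l -> sq^-1 ^+ gap k l <= sq^-1.
  move=> kl; rewrite -(prednK (gap_gt0 kl)) exprS -[leRHS]mulr1 ler_wpM2l // exprn_ile1 //.
  by rewrite invf_le1 ?(ltW sq1) // (lt_trans ltr01).
move=> k; rewrite in_set2 => /orP[] /eqP ->.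
  rewrite (big_pred1 j) ?rle // => l; rewrite in_set2.
  by case: (eqVneq l i) => [->|]; rewrite ?andbF ?andbT //= (negPf ij).
rewrite (big_pred1 i) ?rle 1?eq_sym // => l; rewrite in_set2.
by case: (eqVneq l j) => [->|]; rewrite ?andbF ?andbT ?orbF //= eq_sym (negPf ij).
Qed.
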